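(* Let $\Phi$ be a set of inductive $\mathcal{L}_{\mathrm{SI}}$-sequents and $\Psi$ a set of $\mathcal{L}_\bullet$-sequents. Assume $\Phi\equiv_{\mathsf{ALC}}\Psi$. Then the algebraic sequent system $\mathsf{BDFNL}(\Psi)$ is a conservative extension of $\mathbf{S}_{\mathbb{BDI}}(\Phi)$; that is, an $\mathcal{L}_{\mathrm{SI}}$-sequent is derivable in $\mathbf{S}_{\mathbb{BDI}}(\Phi)$ if and only if it is derivable in $\mathsf{BDFNL}(\Psi)$.
   Context: Languages. Formulas are built from propositional variables and the constants $\top,\bot$: $\mathcal{L}_{\mathrm{SI}}$ uses $\wedge,\vee,\to$; $\mathcal{L}_{\mathrm{LC}}$ uses $\wedge,\vee,\to,\bullet,\leftarrow$; $\mathcal{L}_\bullet$ uses only $\bullet$. A sequent is $\phi\vdash\psi$ with $\phi,\psi$ formulas; an $\mathcal{L}_{\mathrm{LC}}$-supersequent is $\Theta\Rightarrow\chi\vdash\delta$ with $\Theta$ a set of $\mathcal{L}_{\mathrm{LC}}$-sequents (written without $\Theta$ if it is empty). Systems. $\mathbf{S}_{\mathbb{BDI}}$ (for $\mathcal{L}_{\mathrm{SI}}$) has axioms $\phi\vdash\phi$; $\phi\wedge(\psi\vee\gamma)\vdash(\phi\wedge\psi)\vee(\phi\wedge\gamma)$; $\phi\vdash\top$; $\bot\vdash\phi$; $\top\vdash\phi\to\top$; $\top\vdash\bot\to\phi$; $(\phi\to\psi)\wedge(\phi\to\gamma)\vdash\phi\to(\psi\wedge\gamma)$; $(\phi\to\gamma)\wedge(\psi\to\gamma)\vdash(\phi\vee\psi)\to\gamma$;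 and rules: from $\phi\vdash\psi$ infer $\chi\to\phi\vdash\chi\to\psi$ and $\psi\to\chi\vdash\phi\to\chi$; from $\phi_i\vdash\psi$ infer $\phi_1\wedge\phi_2\vdash\psi$ ($i=1,2$); from $\gamma\vdash\phi$, $\gamma\vdash\psi$ infer $\gamma\vdash\phi\wedge\psi$; from $\phi\vdash\chi$, $\psi\vdash\chi$ infer $\phi\vee\psi\vdash\chi$; from $\psi\vdash\phi_i$ infer $\psi\vdash\phi_1\vee\phi_2$ ($i=1,2$); from $\phi\vdash\psi$, $\psi\vdash\gamma$ infer $\phi\vdash\gamma$. $\mathsf{BDFNL}$ (for $\mathcal{L}_{\mathrm{LC}}$) has axioms $\phi\vdash\phi$; $\phi\vdash\top$; $\bot\vdash\phi$; $\phi\wedge(\psi\vee\gamma)\vdash(\phi\wedge\psi)\vee(\phi\wedge\gamma)$; the same rules for $\wedge$, $\vee$ and cut; and the residuation rules: each of $\phi\bullet\psi\vdash\gamma$, $\psi\vdash\phi\to\gamma$ can be inferred from the other, and each of $\phi\bullet\psi\vdash\gamma$, $\phi\vdash\gamma\leftarrow\psi$ can be inferred from the other. $\mathbf{S}_{\mathbb{BDI}}(\Phi)$, resp. $\mathsf{BDFNL}(\Psi)$, is obtained by adding all substitution instances (in the respective language) of sequents in $\Phi$, resp. $\Psi$, as axioms. Inductive sequents. The positive (negative) signed generation tree $+s$ ($-s$) of an $\mathcal{L}_{\mathrm{SI}}$-formula $s$ labels the root of its generation tree by $+$ ($-$); children of $\wedge,\vee$ nodes inherit the sign; for an $\to$ node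 the first child gets the opposite sign and the second child the same sign. Node types: Skeleton nodes are the $\Delta$-adjoints $+\vee,+\wedge,-\wedge,-\vee$ and the SLR nodes $+\wedge,-\vee,-\to$; PIA nodes are the SRA nodes $+\wedge,-\vee$ and the SRR nodes $+\vee,+\to,-\wedge$. Let $\varepsilon\in\{1,\partial\}^n$. An $\varepsilon$-critical node is a leaf $+p_i$ with $\varepsilon_i=1$ or $-p_i$ with $\varepsilon_i=\partial$; an $\varepsilon$-critical branch is a branch from such a leaf. A branch is good if it is the concatenation of paths $P_1$ (starting at the leaf) and $P_2$, one possibly of length $0$, where apart from variable nodes $P_1$ consists only of PIA nodes and $P_2$ only of Skeleton nodes. For a strict partial order $<_\Omega$ on $p_1,\dots,p_n$, a signed tree $*s$ is $(\Omega,\varepsilon)$-inductive if (1) every $\varepsilon$-critical branch (with leaf $p_i$) is good, and (2) for every $m$-ary SRR node $\circledast(\gamma_1,\dots,\gamma_{j-1},\beta,\gamma_{j+1},\dots,\gamma_m)$ in such a critical branch (the branch passing through $\beta$) and every $h\ne j$: every variable leaf of $\gamma_h$, with the sign inherited from $*s$, is $\varepsilon^\partial$-critical ($\varepsilon^\partial$ the opposite order-type), and $p_k<_\Omega p_i$ for every $p_k$ occurring in $\gamma_h$. A sequent $s\vdash t$ (identified with the inequality $s\le t$) is inductive if for some $\Omega,\varepsilon$ both $+s$ and $-t$ are $(\Omega,\varepsilon)$-inductive. Calculus $\mathsf{ALC}$. It acts on $\mathcal{L}_{\mathrm{LC}}$-supersequents; in each rule $S/\!/S'$ below, $S$ and $S'$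 may be derived from each other. Rules changing only one assumption (the rest $\Theta\Rightarrow\chi\vdash\delta$ is unchanged): Splitting: $\gamma\vdash\phi\wedge\psi$ $/\!/$ $\gamma\vdash\phi,\ \gamma\vdash\psi$; $\phi\vee\psi\vdash\gamma$ $/\!/$ $\phi\vdash\gamma,\ \psi\vdash\gamma$. Residuation: $\psi\vdash\phi\to\gamma$ $/\!/$ $\phi\bullet\psi\vdash\gamma$; $\phi\vdash\gamma\leftarrow\psi$ $/\!/$ $\phi\bullet\psi\vdash\gamma$. Approximation, with $p$ a fresh variable (not occurring in the previous derivation): $\phi\to\psi\vdash\gamma$ $/\!/$ $p\vdash\phi,\ p\to\psi\vdash\gamma$; $\phi\to\psi\vdash\gamma$ $/\!/$ $\psi\vdash p,\ \phi\to p\vdash\gamma$; $\gamma\vdash\phi\to\psi$ $/\!/$ $\phi\vdash p,\ \gamma\vdash p\to\psi$; $\gamma\vdash\phi\to\psi$ $/\!/$ $p\vdash\psi,\ \gamma\vdash\phi\to p$; $\phi\vdash\psi\bullet\gamma$ $/\!/$ $p\vdash\psi,\ \phi\vdash p\bullet\gamma$; $\phi\vdash\psi\bullet\gamma$ $/\!/$ $p\vdash\gamma,\ \phi\vdash\psi\bullet p$; $\phi\bullet\psi\vdash\gamma$ $/\!/$ $\phi\vdash p,\ p\bullet\psi\vdash\gamma$; $\phi\bullet\psi\vdash\gamma$ $/\!/$ $\psi\vdash p,\ \phi\bullet p\vdash\gamma$; $\phi\wedge\psi\vdash\gamma$ $/\!/$ $\phi\vdash p,\ p\wedge\psi\vdash\gamma$;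 $\phi\wedge\psi\vdash\gamma$ $/\!/$ $\psi\vdash p,\ \phi\wedge p\vdash\gamma$; $\phi\vdash\psi\vee\gamma$ $/\!/$ $p\vdash\psi,\ \phi\vdash p\vee\gamma$; $\phi\vdash\psi\vee\gamma$ $/\!/$ $p\vdash\gamma,\ \phi\vdash\psi\vee p$. Rules involving the conclusion: $\Theta\Rightarrow\psi\vdash\phi\to\gamma$ $/\!/$ $\Theta\Rightarrow\phi\bullet\psi\vdash\gamma$; $\Theta\Rightarrow\phi\vdash\gamma\leftarrow\psi$ $/\!/$ $\Theta\Rightarrow\phi\bullet\psi\vdash\gamma$; and for fresh $p$: $\Theta\Rightarrow\phi\vdash\psi$ $/\!/$ $p\vdash\phi,\Theta\Rightarrow p\vdash\psi$; $\Theta\Rightarrow\phi\vdash\psi$ $/\!/$ $\psi\vdash p,\Theta\Rightarrow\phi\vdash p$. Ackermann rules: (RAck) $\phi_1\vdash p,\dots,\phi_n\vdash p,\Theta,\Theta'\Rightarrow\chi\vdash\delta$ $/\!/$ $\Theta[\alpha/p],\Theta'\Rightarrow(\chi\vdash\delta)[\alpha/p]$ with $\alpha=\bigvee_{i=1}^n\phi_i$, provided $p$ does not occur in $\Theta'$ or any $\phi_i$, each sequent $\psi_j\vdash\gamma_j$ in the finite set $\Theta$ has $\psi_j$ positive and $\gamma_j$ negative in $p$, and either $p$ does not occur in $\chi\vdash\delta$ or $\chi\vdash\delta$ is positive in $p$ ($\chi$ negative and $\delta$ positive in $p$). (LAck) $p\vdash\phi_1,\dots,p\vdash\phi_n,\Theta,\Theta'\Rightarrow\chi\vdash\delta$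 $/\!/$ $\Theta[\alpha/p],\Theta'\Rightarrow(\chi\vdash\delta)[\alpha/p]$ with $\alpha=\bigwedge_{i=1}^n\phi_i$, provided $p$ does not occur in $\Theta'$ or any $\phi_i$, each $\psi_j\vdash\gamma_j$ in the finite set $\Theta$ has $\psi_j$ negative and $\gamma_j$ positive in $p$, and either $p$ does not occur in $\chi\vdash\delta$ or $\chi\vdash\delta$ is negative in $p$ ($\chi$ positive and $\delta$ negative in $p$). $\Phi\equiv_{\mathsf{ALC}}\Psi$ means that $\Psi$ consists of the $\mathcal{L}_\bullet$-sequents obtained from the sequents in $\Phi$ using $\mathsf{ALC}$: each $\phi\vdash\psi$ in $\Phi$ is transformed into a sequent $\chi\vdash\delta$ in $\Psi$ by an $\mathsf{ALC}$-derivation of $\Rightarrow\chi\vdash\delta$ from $\Rightarrow\phi\vdash\psi$, and every member of $\Psi$ arises in this way. *)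

(* Defs.v *)
From Stdlib Require List.
From Stdlib Require Import RelationClasses.
From mathcomp Require Import all_boot.
From mathcomp Require Import boolp classical_sets cardinality.

Set Implicit Arguments.
Unset Strict Implicit.
Unset Printing Implicit Defensive.

Local Open Scope classical_set_scope.

Inductive si_form : Type :=
| SVar (p : nat) | STop | SBot
| SAnd (a b : si_form) | SOr (a b : si_form) | SImp (a b : si_form).

Inductive lc_form : Type :=
| LVar (p : nat) | LTop | LBot
| LAnd (a b : lc_form) | LOr (a b : lc_form) | LImp (a b : lc_form)
| LFus (a b : lc_form)
| LCoimp (a b : lc_form) (** [LCoimp a b] is [a ← b] *).

(** The constants belong to all three languages. *)
Inductive bul_form : Type :=
| BVar (p : nat) | BTop | BBot
| BFus (a b : bul_form).

Declare Scope si_scope.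
Delimit Scope si_scope with SI.
Bind Scope si_scope with si_form.
Declare Scope lc_scope.
Delimit Scope lc_scope with LC.
Bind Scope lc_scope with lc_form.

Reserved Notation "a • b" (at level 39, left associativity).
Reserved Notation "a ⊓ b" (at level 42, left associativity).
Reserved Notation "a ⊔ b" (at level 45, left associativity).
Reserved Notation "a ⇀ b" (at level 47, right associativity).
Reserved Notation "a ↽ b" (at level 47, right associativity).
Reserved Notation "a ⊢ b" (at level 68, no associativity).
Reserved Notation "Th ⇒ s" (at level 69, no associativity).

Notation "⊤" := STop : si_scope.
Notation "⊥" := SBot : si_scope.
Infix "⊓" := SAnd : si_scope.
Infix "⊔" := SOr : si_scope.
Infix "⇀" := SImp : si_scope.

Notation "⊤" := LTop : lc_scope.
Notation "⊥" := LBot : lc_scope.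
Infix "⊓" := LAnd : lc_scope.
Infix "⊔" := LOr : lc_scope.
Infix "⇀" := LImp : lc_scope.
Infix "•" := LFus : lc_scope.
Infix "↽" := LCoimp : lc_scope.

Record sequent (F : Type) : Type := Sequent { lhs : F; rhs : F }.
Notation "a ⊢ b" := (Sequent a b).

Definition seq_map (F G : Type) (f : F -> G) (s : sequent F) : sequent G :=
  f (lhs s) ⊢ f (rhs s).

Definition si_sequent := sequent si_form.
Definition lc_sequent := sequent lc_form.
Definition bul_sequent := sequent bul_form.

Fixpoint lc_of_si (a : si_form) : lc_form :=
  match a with
  | SVar p => LVar p
  | STop => LTop
  | SBot => LBot
  | SAnd a b => LAnd (lc_of_si a) (lc_of_si b)
  | SOr a b => LOr (lc_of_si a) (lc_of_si b)
  | SImp a b => LImp (lc_of_si a) (lc_of_si b)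
  end.

Fixpoint lc_of_bul (a : bul_form) : lc_form :=
  match a with
  | BVar p => LVar p
  | BTop => LTop
  | BBot => LBot
  | BFus a b => LFus (lc_of_bul a) (lc_of_bul b)
  end.

Fixpoint si_subst (u : nat -> si_form) (a : si_form) : si_form :=
  match a with
  | SVar p => u p
  | STop => STop
  | SBot => SBot
  | SAnd a b => SAnd (si_subst u a) (si_subst u b)
  | SOr a b => SOr (si_subst u a) (si_subst u b)
  | SImp a b => SImp (si_subst u a) (si_subst u b)
  end.

Fixpoint lc_subst (u : nat -> lc_form) (a : lc_form) : lc_form :=
  match a with
  | LVar p => u p
  | LTop => LTop
  | LBot => LBot
  | LAnd a b => LAnd (lc_subst u a) (lc_subst u b)
  | LOr a b => LOr (lc_subst u a) (lc_subst u b)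
  | LImp a b => LImp (lc_subst u a) (lc_subst u b)
  | LFus a b => LFus (lc_subst u a) (lc_subst u b)
  | LCoimp a b => LCoimp (lc_subst u a) (lc_subst u b)
  end.

Section BDI.
Local Open Scope si_scope.
Variable Phi : set si_sequent.

Inductive S_BDI : si_sequent -> Prop :=
| bdi_ax s u : Phi s -> S_BDI (seq_map (si_subst u) s)
| bdi_id a : S_BDI (a ⊢ a)
| bdi_distr a b c : S_BDI (a ⊓ (b ⊔ c) ⊢ (a ⊓ b) ⊔ (a ⊓ c))
| bdi_top a : S_BDI (a ⊢ ⊤)
| bdi_bot a : S_BDI (⊥ ⊢ a)
| bdi_imp_top a : S_BDI (⊤ ⊢ a ⇀ ⊤)
| bdi_bot_imp a : S_BDI (⊤ ⊢ ⊥ ⇀ a)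
| bdi_imp_and a b c : S_BDI ((a ⇀ b) ⊓ (a ⇀ c) ⊢ a ⇀ (b ⊓ c))
| bdi_or_imp a b c : S_BDI ((a ⇀ c) ⊓ (b ⇀ c) ⊢ (a ⊔ b) ⇀ c)
| bdi_imp_monor a b c : S_BDI (a ⊢ b) -> S_BDI (c ⇀ a ⊢ c ⇀ b)
| bdi_imp_antil a b c : S_BDI (a ⊢ b) -> S_BDI (b ⇀ c ⊢ a ⇀ c)
| bdi_andl1 a1 a2 b : S_BDI (a1 ⊢ b) -> S_BDI (a1 ⊓ a2 ⊢ b)
| bdi_andl2 a1 a2 b : S_BDI (a2 ⊢ b) -> S_BDI (a1 ⊓ a2 ⊢ b)
| bdi_andr a b c : S_BDI (c ⊢ a) -> S_BDI (c ⊢ b) -> S_BDI (c ⊢ a ⊓ b)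
| bdi_orl a b c : S_BDI (a ⊢ c) -> S_BDI (b ⊢ c) -> S_BDI (a ⊔ b ⊢ c)
| bdi_orr1 a1 a2 b : S_BDI (b ⊢ a1) -> S_BDI (b ⊢ a1 ⊔ a2)
| bdi_orr2 a1 a2 b : S_BDI (b ⊢ a2) -> S_BDI (b ⊢ a1 ⊔ a2)
| bdi_cut a b c : S_BDI (a ⊢ b) -> S_BDI (b ⊢ c) -> S_BDI (a ⊢ c).

End BDI.

Section FNL.
Local Open Scope lc_scope.
Variable Psi : set bul_sequent.

Inductive BDFNL : lc_sequent -> Prop :=
| fnl_ax s u : Psi s -> BDFNL (seq_map (lc_subst u) (seq_map lc_of_bul s))
| fnl_id a : BDFNL (a ⊢ a)
| fnl_top a : BDFNL (a ⊢ ⊤)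
| fnl_bot a : BDFNL (⊥ ⊢ a)
| fnl_distr a b c : BDFNL (a ⊓ (b ⊔ c) ⊢ (a ⊓ b) ⊔ (a ⊓ c))
| fnl_andl1 a1 a2 b : BDFNL (a1 ⊢ b) -> BDFNL (a1 ⊓ a2 ⊢ b)
| fnl_andl2 a1 a2 b : BDFNL (a2 ⊢ b) -> BDFNL (a1 ⊓ a2 ⊢ b)
| fnl_andr a b c : BDFNL (c ⊢ a) -> BDFNL (c ⊢ b) -> BDFNL (c ⊢ a ⊓ b)
| fnl_orl a b c : BDFNL (a ⊢ c) -> BDFNL (b ⊢ c) -> BDFNL (a ⊔ b ⊢ c)
| fnl_orr1 a1 a2 b : BDFNL (b ⊢ a1) -> BDFNL (b ⊢ a1 ⊔ a2)
| fnl_orr2 a1 a2 b : BDFNL (b ⊢ a2) -> BDFNL (b ⊢ a1 ⊔ a2)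
| fnl_cut a b c : BDFNL (a ⊢ b) -> BDFNL (b ⊢ c) -> BDFNL (a ⊢ c)
| fnl_imp_intro a b c : BDFNL (a • b ⊢ c) -> BDFNL (b ⊢ a ⇀ c)
| fnl_imp_elim a b c : BDFNL (b ⊢ a ⇀ c) -> BDFNL (a • b ⊢ c)
| fnl_coimp_intro a b c : BDFNL (a • b ⊢ c) -> BDFNL (a ⊢ c ↽ b)
| fnl_coimp_elim a b c : BDFNL (a ⊢ c ↽ b) -> BDFNL (a • b ⊢ c).

End FNL.

(** Signs: [true] is [+] and [false] is [-]. *)
Definition sign := bool.

(** Order-types: [true] is [1] and [false] is [∂]. *)
Definition order_type := nat -> bool.
Definition dual_type (eps : order_type) : order_type := fun i => ~~ eps i.

Definition critical (eps : order_type) (e : sign) (i : nat) : bool :=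
  e == eps i.

Inductive conn := CAnd | COr | CImp.

(** An inner node on a branch of a signed generation tree, together with the
    immediate signed subtree that the branch does not enter. *)
Record branch_node := BranchNode {
  node_sign : sign;
  node_conn : conn;
  side_sign : sign;
  side_form : si_form }.

(** [branch e s b e' i]: in the [e]-signed generation tree of [s], the inner
    nodes on some path from the root to a variable leaf, labelled [p_i] with
    sign [e'], are [b], listed from the root to the leaf. *)
Inductive branch : sign -> si_form -> seq branch_node -> sign -> nat -> Prop :=
| br_var e i : branch e (SVar i) [::] e i
| br_andl e s t b e' i : branch e s b e' i ->
    branch e (SAnd s t) (BranchNode e CAnd e t :: b) e' i
| br_andr e s t b e' i : branch e t b e' i ->
    branch e (SAnd s t) (BranchNode e CAnd e s :: b) e' i
| br_orl e s t b e' i : branch e s b e' i ->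
    branch e (SOr s t) (BranchNode e COr e t :: b) e' i
| br_orr e s t b e' i : branch e t b e' i ->
    branch e (SOr s t) (BranchNode e COr e s :: b) e' i
| br_impl e s t b e' i : branch (~~ e) s b e' i ->
    branch e (SImp s t) (BranchNode e CImp e t :: b) e' i
| br_impr e s t b e' i : branch e t b e' i ->
    branch e (SImp s t) (BranchNode e CImp (~~ e) s :: b) e' i.

Definition is_delta_adjoint (n : branch_node) : bool :=
  match node_sign n, node_conn n with
  | true, COr | true, CAnd | false, CAnd | false, COr => true
  | _, _ => false
  end.

Definition is_SLR (n : branch_node) : bool :=
  match node_sign n, node_conn n with
  | true, CAnd | false, COr | false, CImp => true
  | _, _ => false
  end.

Definition is_SRA (n : branch_node) : bool :=
  match node_sign n, node_conn n with
  | true, CAnd | false, COr => true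
  | _, _ => false
  end.

Definition is_SRR (n : branch_node) : bool :=
  match node_sign n, node_conn n with
  | true, COr | true, CImp | false, CAnd => true
  | _, _ => false
  end.

Definition is_skeleton (n : branch_node) := is_delta_adjoint n || is_SLR n.
Definition is_PIA (n : branch_node) := is_SRA n || is_SRR n.

(** Branches are listed from the root, so the PIA part [P1], which starts at
    the leaf, comes last. *)
Definition good (b : seq branch_node) : Prop :=
  exists P1 P2, [/\ b = P2 ++ P1, all is_PIA P1 & all is_skeleton P2].

Definition inductive_tree (Omega : nat -> nat -> Prop) (eps : order_type)
    (e : sign) (s : si_form) : Prop :=
  forall b e' i, branch e s b e' i -> critical eps e' i ->
    good b /\
    forall b1 n b2, b = b1 ++ n :: b2 -> is_SRR n ->
      forall c d k, branch (side_sign n) (side_form n) c d k ->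
        critical (dual_type eps) d k /\ Omega k i.

(** [Omega] and [eps] only matter on the finitely many variables of [s]; any
    strict order on these is also one on the set of all variables. *)
Definition inductive_sequent (s : si_sequent) : Prop :=
  exists (Omega : nat -> nat -> Prop) (eps : order_type),
    [/\ StrictOrder Omega,
        inductive_tree Omega eps true (lhs s) &
        inductive_tree Omega eps false (rhs s)].

Record supersequent : Type := Supersequent {
  assumptions : set lc_sequent;
  conclusion : lc_sequent }.
Notation "Th ⇒ s" := (Supersequent Th s).

Fixpoint occurs (p : nat) (a : lc_form) : bool :=
  match a with
  | LVar q => q == p
  | LTop | LBot => false
  | LAnd a b | LOr a b | LImp a b | LFus a b | LCoimp a b =>
      occurs p a || occurs p b
  end.

Definition seq_occurs (p : nat) (s : lc_sequent) : bool :=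
  occurs p (lhs s) || occurs p (rhs s).

Definition set_occurs (p : nat) (Th : set lc_sequent) : Prop :=
  exists2 s, Th s & seq_occurs p s.

Definition ss_occurs (p : nat) (S : supersequent) : Prop :=
  set_occurs p (assumptions S) \/ seq_occurs p (conclusion S).

(** All occurrences of [p] in the [e]-signed generation tree of [a] are
    labelled [+]. *)
Fixpoint all_plus (p : nat) (e : sign) (a : lc_form) : bool :=
  match a with
  | LVar q => (q == p) ==> e
  | LTop | LBot => true
  | LAnd a b | LOr a b | LFus a b => all_plus p e a && all_plus p e b
  | LImp a b => all_plus p (~~ e) a && all_plus p e b
  | LCoimp a b => all_plus p e a && all_plus p (~~ e) b
  end.

Definition positive (p : nat) (a : lc_form) : bool := all_plus p true a.
Definition negative (p : nat) (a : lc_form) : bool := all_plus p false a.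

Definition seq_positive (p : nat) (s : lc_sequent) : bool :=
  negative p (lhs s) && positive p (rhs s).
Definition seq_negative (p : nat) (s : lc_sequent) : bool :=
  positive p (lhs s) && negative p (rhs s).

Definition subst1 (p : nat) (alpha : lc_form) : lc_form -> lc_form :=
  lc_subst (fun q => if q == p then alpha else LVar q).

(** The empty join is [⊥], the empty meet is [⊤]; a one-element join or meet
    is its only member. *)
Fixpoint big_or (l : seq lc_form) : lc_form :=
  match l with
  | [::] => LBot
  | [:: a] => a
  | a :: l' => LOr a (big_or l')
  end.

Fixpoint big_and (l : seq lc_form) : lc_form :=
  match l with
  | [::] => LTop
  | [:: a] => a
  | a :: l' => LAnd a (big_and l')
  end.

Definition all_below (l : seq lc_form) (p : nat) : set lc_sequent :=
  [set a ⊢ LVar p | a in [set a | List.In a l]].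
Definition all_above (p : nat) (l : seq lc_form) : set lc_sequent :=
  [set LVar p ⊢ a | a in [set a | List.In a l]].

Section ALC_rules.
Local Open Scope lc_scope.

(** [assumption_rule A B]: the assumption [A] may be replaced by the
    assumptions [B], and conversely. *)
Inductive assumption_rule : lc_sequent -> set lc_sequent -> Prop :=
| split_and a b c : assumption_rule (c ⊢ a ⊓ b) [set (c ⊢ a); (c ⊢ b)]
| split_or a b c : assumption_rule (a ⊔ b ⊢ c) [set (a ⊢ c); (b ⊢ c)]
| resid_imp a b c : assumption_rule (b ⊢ a ⇀ c) [set (a • b ⊢ c)]
| resid_coimp a b c : assumption_rule (a ⊢ c ↽ b) [set (a • b ⊢ c)].

Inductive approximation_rule (p : nat) : lc_sequent -> set lc_sequent -> Prop :=
| apx_imp_l1 a b c : approximation_rule p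
    (a ⇀ b ⊢ c) [set (LVar p ⊢ a); (LVar p ⇀ b ⊢ c)]
| apx_imp_l2 a b c : approximation_rule p
    (a ⇀ b ⊢ c) [set (b ⊢ LVar p); (a ⇀ LVar p ⊢ c)]
| apx_imp_r1 a b c : approximation_rule p
    (c ⊢ a ⇀ b) [set (a ⊢ LVar p); (c ⊢ LVar p ⇀ b)]
| apx_imp_r2 a b c : approximation_rule p
    (c ⊢ a ⇀ b) [set (LVar p ⊢ b); (c ⊢ a ⇀ LVar p)]
| apx_fus_r1 a b c : approximation_rule p
    (a ⊢ b • c) [set (LVar p ⊢ b); (a ⊢ LVar p • c)]
| apx_fus_r2 a b c : approximation_rule p
    (a ⊢ b • c) [set (LVar p ⊢ c); (a ⊢ b • LVar p)]
| apx_fus_l1 a b c : approximation_rule p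
    (a • b ⊢ c) [set (a ⊢ LVar p); (LVar p • b ⊢ c)]
| apx_fus_l2 a b c : approximation_rule p
    (a • b ⊢ c) [set (b ⊢ LVar p); (a • LVar p ⊢ c)]
| apx_and_l1 a b c : approximation_rule p
    (a ⊓ b ⊢ c) [set (a ⊢ LVar p); (LVar p ⊓ b ⊢ c)]
| apx_and_l2 a b c : approximation_rule p
    (a ⊓ b ⊢ c) [set (b ⊢ LVar p); (a ⊓ LVar p ⊢ c)]
| apx_or_r1 a b c : approximation_rule p
    (a ⊢ b ⊔ c) [set (LVar p ⊢ b); (a ⊢ LVar p ⊔ c)]
| apx_or_r2 a b c : approximation_rule p
    (a ⊢ b ⊔ c) [set (LVar p ⊢ c); (a ⊢ b ⊔ LVar p)].

Inductive plain_rule : supersequent -> supersequent -> Prop :=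
| rule_assumption A B Th s : assumption_rule A B ->
    plain_rule (A |` Th ⇒ s) (B `|` Th ⇒ s)
| rule_resid_imp Th a b c :
    plain_rule (Th ⇒ (b ⊢ a ⇀ c)) (Th ⇒ (a • b ⊢ c))
| rule_resid_coimp Th a b c :
    plain_rule (Th ⇒ (a ⊢ c ↽ b)) (Th ⇒ (a • b ⊢ c))
| rule_RAck (l : seq lc_form) p Th Th' s :
    finite_set Th ->
    ~ set_occurs p Th' ->
    (forall a, List.In a l -> ~~ occurs p a) ->
    (forall t, Th t -> positive p (lhs t) /\ negative p (rhs t)) ->
    ~~ seq_occurs p s \/ seq_positive p s ->
    plain_rule
      (all_below l p `|` Th `|` Th' ⇒ s)
      ([set seq_map (subst1 p (big_or l)) t | t in Th] `|` Th'
         ⇒ seq_map (subst1 p (big_or l)) s)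
| rule_LAck (l : seq lc_form) p Th Th' s :
    finite_set Th ->
    ~ set_occurs p Th' ->
    (forall a, List.In a l -> ~~ occurs p a) ->
    (forall t, Th t -> negative p (lhs t) /\ positive p (rhs t)) ->
    ~~ seq_occurs p s \/ seq_negative p s ->
    plain_rule
      (all_above p l `|` Th `|` Th' ⇒ s)
      ([set seq_map (subst1 p (big_and l)) t | t in Th] `|` Th'
         ⇒ seq_map (subst1 p (big_and l)) s).

(** The rules [S // S'] in which [S'] contains the fresh variable [p]. *)
Inductive fresh_rule (p : nat) : supersequent -> supersequent -> Prop :=
| rule_approximation A B Th s : approximation_rule p A B ->
    fresh_rule p (A |` Th ⇒ s) (B `|` Th ⇒ s)
| rule_approx_concl_l Th a b :
    fresh_rule p (Th ⇒ (a ⊢ b)) ((LVar p ⊢ a) |` Th ⇒ (LVar p ⊢ b))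
| rule_approx_concl_r Th a b :
    fresh_rule p (Th ⇒ (a ⊢ b)) ((b ⊢ LVar p) |` Th ⇒ (a ⊢ LVar p)).

End ALC_rules.

(** [ALC_derivation S0 D S]: there is a derivation that starts with [S0] and
    ends with [S], where [D] lists its supersequents, the last one first.
    A variable introduced by a fresh-variable rule does not occur anywhere
    earlier in the derivation; when such a rule is read upwards, the variable it
    eliminates does not occur in the resulting supersequent. *)
Inductive ALC_derivation (S0 : supersequent) :
    seq supersequent -> supersequent -> Prop :=
| alc_start : ALC_derivation S0 [:: S0] S0
| alc_plain_down D S S' : ALC_derivation S0 D S -> plain_rule S S' ->
    ALC_derivation S0 (S' :: D) S'
| alc_plain_up D S S' : ALC_derivation S0 D S' -> plain_rule S S' ->
    ALC_derivation S0 (S :: D) S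
| alc_fresh_down p D S S' : ALC_derivation S0 D S -> fresh_rule p S S' ->
    (forall T, List.In T D -> ~ ss_occurs p T) ->
    ALC_derivation S0 (S' :: D) S'
| alc_fresh_up p D S S' : ALC_derivation S0 D S' -> fresh_rule p S S' ->
    ~ ss_occurs p S ->
    ALC_derivation S0 (S :: D) S.

Definition ALC_derives (s t : lc_sequent) : Prop :=
  exists D, ALC_derivation (set0 ⇒ s) D (set0 ⇒ t).

Definition ALC_equiv (Phi : set si_sequent) (Psi : set bul_sequent) : Prop :=
  (forall s, Phi s -> exists2 t, Psi t &
     ALC_derives (seq_map lc_of_si s) (seq_map lc_of_bul t)) /\
  (forall t, Psi t -> exists2 s, Phi s &
     ALC_derives (seq_map lc_of_si s) (seq_map lc_of_bul t)).

(* Main.v *)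
From Stdlib Require Import RelationClasses.
From mathcomp Require Import all_boot.
From mathcomp Require Import boolp classical_sets.
Require Import Defs.

Set Implicit Arguments.
Unset Strict Implicit.
Unset Printing Implicit Defensive.

Local Open Scope classical_set_scope.

(** Both inclusions rest on algebras: bounded distributive lattices with a
    binary operation that has residuals in both coordinates.  Reading a
    supersequent as a quasi-inequality, every ALC rule preserves and reflects
    validity in each such algebra (a fresh variable is interpreted by the
    subformula that it replaces, an Ackermann variable by the join or meet that
    is substituted for it).  So a sequent and its ALC-transform are valid in the
    same algebras ([ALC_derives_valid]).

    Hence the Lindenbaum algebra of the residuated calculus, which validates
    [Psi], validates [Phi], and the implicational system is contained in the
    residuated one.

    For conservativity, let the points be the prime filters of formulas of the
    implicational system, with the ternary relation [rel x y z]: if [a -> b] is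
    in [x] and [a] in [y], then [b] is in [z].  The upsets of points form an
    algebra of the above kind, and the formulas embed in it
    ([truth_lemma]), so a sequent that is not derivable fails there.  If this
    algebra validates [Phi], then it validates [Psi], and the sequent is not
    derivable in the residuated calculus either.

    It remains to see that inductive sequents are canonical: if all instances
    of [s] are derivable, then [s] holds under all valuations by upsets
    ([inductive_canonical]).  Suppose that [s] fails at [x] under [v].  The
    Skeleton nodes of the two signed trees reduce the failure to finitely many
    demands, each saying that a PIA formula holds, or fails, at some point; the
    SRR nodes of the PIA formulas are moved to the point by residuation
    ([source_residual]), which leaves a bound for every critical variable.  The
    bounds, computed recursively along the order of the variables, give a
    minimal valuation below [v] whose values are closed or open, that is, given
    by filters or ideals of formulas ([minval]).  The noncritical parts hold at
    the minimal valuation, and by compactness ([noncrit_approx]) at some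
    approximation of it by formulas.  Refining the approximation from the
    largest variable down ([solvable_diag]) yields a substitution [u] whose
    instance of [s] fails at [x], so it is not derivable. *)

(** * Residuated algebras and the soundness of the ALC rules *)

(** Bounded distributive lattices with a binary operation [fus] that has
    residuals in both coordinates.  The order is only a preorder, so that
    formulas ordered by derivability are an instance without quotients. *)
Record fnl_algebra := FnlAlgebra {
  car : Type;
  le : car -> car -> Prop;
  top : car; bot : car;
  meet : car -> car -> car; join : car -> car -> car;
  imp : car -> car -> car; fus : car -> car -> car; coimp : car -> car -> car;
  le_refl : forall a, le a a;
  le_trans : forall b a c, le a b -> le b c -> le a c;
  le_top : forall a, le a top;
  bot_le : forall a, le bot a;
  meet_l : forall a b, le (meet a b) a;
  meet_r : forall a b, le (meet a b) b;
  meet_glb : forall a b c, le c a -> le c b -> le c (meet a b);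
  join_l : forall a b, le a (join a b);
  join_r : forall a b, le b (join a b);
  join_lub : forall a b c, le a c -> le b c -> le (join a b) c;
  meet_join : forall a b c,
    le (meet a (join b c)) (join (meet a b) (meet a c));
  imp_adj : forall a b c, le (fus a b) c <-> le b (imp a c);
  coimp_adj : forall a b c, le (fus a b) c <-> le a (coimp c b) }.

#[global] Hint Resolve le_refl le_top bot_le meet_l meet_r join_l join_r : core.
Arguments le_trans {f} b {a c}.

Section Algebra.
Variable A : fnl_algebra.
Implicit Types (a b c d : car A) (v w : nat -> car A) (f g : lc_form).
Local Notation "a ≤ b" := (@le A a b) (at level 70).

Lemma meet_mono a b c d : a ≤ c -> b ≤ d -> meet a b ≤ meet c d.
Proof.
move=> ac bd; apply: meet_glb.
  exact: le_trans (meet_l a b) ac.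
exact: le_trans (meet_r a b) bd.
Qed.

Lemma join_mono a b c d : a ≤ c -> b ≤ d -> join a b ≤ join c d.
Proof.
move=> ac bd; apply: join_lub.
  exact: le_trans ac (join_l c d).
exact: le_trans bd (join_r c d).
Qed.

Lemma fus_mono a b c d : a ≤ c -> b ≤ d -> fus a b ≤ fus c d.
Proof.
move=> ac bd; apply: (le_trans (fus c b)).
  apply/coimp_adj; apply: le_trans ac _.
  exact/coimp_adj.
apply/imp_adj; apply: le_trans bd _.
exact/imp_adj.
Qed.

Lemma imp_mono a b c d : c ≤ a -> b ≤ d -> imp a b ≤ imp c d.
Proof.
move=> ca bd; apply/imp_adj; apply: le_trans bd.
apply: (le_trans (fus a (imp a b))); first exact: fus_mono.
exact/imp_adj.
Qed.

Lemma coimp_mono a b c d : a ≤ c -> d ≤ b -> coimp a b ≤ coimp c d.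
Proof.
move=> ac db; apply/coimp_adj; apply: le_trans ac.
apply: (le_trans (fus (coimp a b) b)); first exact: fus_mono.
exact/coimp_adj.
Qed.

Fixpoint eval v f : car A :=
  match f with
  | LVar p => v p
  | LTop => top A
  | LBot => bot A
  | LAnd f g => meet (eval v f) (eval v g)
  | LOr f g => join (eval v f) (eval v g)
  | LImp f g => imp (eval v f) (eval v g)
  | LFus f g => fus (eval v f) (eval v g)
  | LCoimp f g => coimp (eval v f) (eval v g)
  end.

Definition holds v (s : lc_sequent) : Prop := eval v (lhs s) ≤ eval v (rhs s).

(** A supersequent is read as a quasi-inequality. *)
Definition ss_valid (S : supersequent) : Prop :=
  forall v, (forall t, assumptions S t -> holds v t) -> holds v (conclusion S).

Definition upd v p a : nat -> car A := fun q => if q == p then a else v q.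

Lemma upd_eq v p a : upd v p a p = a.
Proof. by rewrite /upd eqxx. Qed.

Lemma eval_subst v u f :
  eval v (lc_subst u f) = eval (fun p => eval v (u p)) f.
Proof. by elim: f => //= f -> g ->. Qed.

Lemma eval_upd_fresh v p a f : ~~ occurs p f -> eval (upd v p a) f = eval v f.
Proof.
elim: f => //= [q|f IHf g IHg|f IHf g IHg|f IHf g IHg|f IHf g IHg|f IHf g IHg];
  rewrite ?negb_or.
  by rewrite /upd => /negbTE ->.
all: by case/andP=> /IHf -> /IHg ->.
Qed.

Lemma eval_subst1 v p g f :
  eval v (subst1 p g f) = eval (upd v p (eval v g)) f.
Proof.
rewrite eval_subst; congr eval; apply/funext => q.
by rewrite /upd; case: eqP.
Qed.

Lemma holds_subst1 v p g s :
  holds v (seq_map (subst1 p g) s) = holds (upd v p (eval v g)) s.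
Proof. by rewrite /holds /= !eval_subst1. Qed.

Lemma holds_upd_fresh v p a s :
  ~~ seq_occurs p s -> holds (upd v p a) s = holds v s.
Proof.
by rewrite /seq_occurs negb_or /holds => /andP[? ?]; rewrite !eval_upd_fresh.
Qed.

Lemma eval_all_plus v w p f e : (forall q, q != p -> v q = w q) ->
  v p ≤ w p -> all_plus p e f ->
  if e then eval v f ≤ eval w f else eval w f ≤ eval v f.
Proof.
move=> vw vwp.
elim: f e => [q|||f IHf g IHg|f IHf g IHg|f IHf g IHg|f IHf g IHg|f IHf g IHg]
  e /=.
- case: eqVneq => [->|/vw ->]; first by case: e.
  by case: e.
- by case: e.
- by case: e.
all: case/andP=> /IHf hf /IHg hg; case: e hf hg => /= hf hg.
all: by [apply: meet_mono | apply: join_mono | apply: imp_mono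
  | apply: fus_mono | apply: coimp_mono].
Qed.

Lemma eval_positive v p a b f : a ≤ b -> positive p f ->
  eval (upd v p a) f ≤ eval (upd v p b) f.
Proof.
move=> ab; apply: (@eval_all_plus _ _ p f true); last by rewrite !upd_eq.
by move=> q /negbTE qp; rewrite /upd qp.
Qed.

Lemma eval_negative v p a b f : a ≤ b -> negative p f ->
  eval (upd v p b) f ≤ eval (upd v p a) f.
Proof.
move=> ab; apply: (@eval_all_plus _ _ p f false); last by rewrite !upd_eq.
by move=> q /negbTE qp; rewrite /upd qp.
Qed.

Lemma big_or_lub v l a :
  eval v (big_or l) ≤ a <-> (forall f, List.In f l -> eval v f ≤ a).
Proof.
elim: l => [|f [|g l] IH] /=.
- by split=> // _; apply: bot_le.
- by split=> [fa h [<-|[]]|] //; apply; left.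
- split=> [fa h [<-|hl]|fa].
  + exact: le_trans fa.
  + by apply: (proj1 IH) hl; apply: le_trans fa.
  + by apply: join_lub; [apply: fa; left|apply/IH => h hl; apply: fa; right].
Qed.

Lemma big_and_glb v l a :
  a ≤ eval v (big_and l) <-> (forall f, List.In f l -> a ≤ eval v f).
Proof.
elim: l => [|f [|g l] IH] /=.
- by split=> // _; apply: le_top.
- by split=> [fa h [<-|[]]|] //; apply; left.
- split=> [fa h [<-|hl]|fa].
  + exact: le_trans fa _.
  + by apply: (proj1 IH) hl; apply: le_trans fa _.
  + by apply: meet_glb; [apply: fa; left|apply/IH => h hl; apply: fa; right].
Qed.

Lemma assumption_rule_holds v s B : assumption_rule s B ->
  holds v s <-> (forall t, B t -> holds v t).
Proof.
case=> f g h; rewrite /holds /=.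
- split=> [hfg t [->|->] /=|H].
  + exact: le_trans hfg _.
  + exact: le_trans hfg _.
  + by apply: meet_glb; [apply: (H (h ⊢ f)); left|apply: (H (h ⊢ g)); right].
- split=> [hfg t [->|->] /=|H].
  + exact: le_trans hfg.
  + exact: le_trans hfg.
  + by apply: join_lub; [apply: (H (f ⊢ h)); left|apply: (H (g ⊢ h)); right].
- split=> [hfg t -> /=|H]; first exact/imp_adj.
  by apply/imp_adj; apply: (H (LFus f g ⊢ h)).
- split=> [hfg t -> /=|H]; first exact/coimp_adj.
  by apply/coimp_adj; apply: (H (LFus f g ⊢ h)).
Qed.

Lemma holds_pair v s t :
  (forall r, [set s; t] r -> holds v r) -> holds v s /\ holds v t.
Proof. by move=> H; split; apply: H; [left|right]. Qed.

Lemma approximation_rule_sound v p s B : approximation_rule p s B ->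
  (forall t, B t -> holds v t) -> holds v s.
Proof.
case=> f g h /holds_pair[]; rewrite /holds /= => H1;
  first [apply: le_trans | move=> H2; apply: (le_trans _ H2)].
all: by apply: meet_mono || apply: join_mono || apply: imp_mono
   || apply: fus_mono.
Qed.

(** The fresh variable is given the value of the subformula that it
    replaces. *)
Lemma approximation_rule_complete v p s B : approximation_rule p s B ->
  ~~ seq_occurs p s -> holds v s ->
  exists a, forall t, B t -> holds (upd v p a) t.
Proof.
have pair f g f' g' a : 
  eval (upd v p a) f ≤ eval (upd v p a) g ->
  eval (upd v p a) f' ≤ eval (upd v p a) g' ->
  exists a, forall t, [set f ⊢ g; f' ⊢ g'] t -> holds (upd v p a) t.
  by move=> H1 H2; exists a; move=> t [->|->].
case=> f g h; rewrite /seq_occurs /= !negb_or -?andbA => /and3P[pf pg ph];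
  rewrite /holds /= => H;
  [apply: pair (eval v f) _ _ | apply: pair (eval v g) _ _
  |apply: pair (eval v f) _ _ | apply: pair (eval v g) _ _
  |apply: pair (eval v g) _ _ | apply: pair (eval v h) _ _
  |apply: pair (eval v f) _ _ | apply: pair (eval v g) _ _
  |apply: pair (eval v f) _ _ | apply: pair (eval v g) _ _
  |apply: pair (eval v g) _ _ | apply: pair (eval v h) _ _];
  by rewrite /= ?upd_eq !eval_upd_fresh.
Qed.

Lemma RAck_valid l p Th Th' s : ~ set_occurs p Th' ->
  (forall f, List.In f l -> ~~ occurs p f) ->
  (forall t, Th t -> positive p (lhs t) /\ negative p (rhs t)) ->
  ~~ seq_occurs p s \/ seq_positive p s ->
  ss_valid (Supersequent (all_below l p `|` Th `|` Th') s) <->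
  ss_valid (Supersequent ([set seq_map (subst1 p (big_or l)) t | t in Th] `|` Th')
    (seq_map (subst1 p (big_or l)) s)).
Proof.
move=> pTh' pl pTh ps; split=> H v /= Hv.
  rewrite holds_subst1; apply: H => t /= [[[f fl <-]|Tht]|Th't].
  - rewrite /holds /= upd_eq eval_upd_fresh ?pl //.
    by move: (le_refl (eval v (big_or l))) => /big_or_lub; apply.
  - by rewrite -holds_subst1; apply: Hv; left; exists t.
  - rewrite holds_upd_fresh; first by apply: Hv; right.
    by apply/negP => pt; apply: pTh'; exists t.
have vE : v = upd v p (v p).
  by apply/funext => q; rewrite /upd; case: eqP => [->|].
have ap : eval v (big_or l) ≤ v p.
  by apply/big_or_lub => f fl; apply: (Hv (f ⊢ LVar p)); left; left; exists f.
have : holds v (seq_map (subst1 p (big_or l)) s).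
  apply: H => r [[t Tht <-]|Th't]; last by apply: Hv; right.
  rewrite holds_subst1 /holds; have [pos neg] := pTh _ Tht.
  apply: le_trans (eval_positive v ap pos) _.
  apply: le_trans (eval_negative v ap neg); rewrite -vE.
  by apply: Hv; left; right.
rewrite holds_subst1; case: ps => [ps|/andP[neg pos]].
  by rewrite holds_upd_fresh.
rewrite /holds => Hs; rewrite vE.
apply: le_trans (eval_negative v ap neg) _.
exact: le_trans Hs (eval_positive v ap pos).
Qed.

Lemma LAck_valid l p Th Th' s : ~ set_occurs p Th' ->
  (forall f, List.In f l -> ~~ occurs p f) ->
  (forall t, Th t -> negative p (lhs t) /\ positive p (rhs t)) ->
  ~~ seq_occurs p s \/ seq_negative p s ->
  ss_valid (Supersequent (all_above p l `|` Th `|` Th') s) <->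
  ss_valid (Supersequent ([set seq_map (subst1 p (big_and l)) t | t in Th] `|` Th')
    (seq_map (subst1 p (big_and l)) s)).
Proof.
move=> pTh' pl pTh ps; split=> H v /= Hv.
  rewrite holds_subst1; apply: H => t /= [[[f fl <-]|Tht]|Th't].
  - rewrite /holds /= upd_eq eval_upd_fresh ?pl //.
    by move: (le_refl (eval v (big_and l))) => /big_and_glb; apply.
  - by rewrite -holds_subst1; apply: Hv; left; exists t.
  - rewrite holds_upd_fresh; first by apply: Hv; right.
    by apply/negP => pt; apply: pTh'; exists t.
have vE : v = upd v p (v p).
  by apply/funext => q; rewrite /upd; case: eqP => [->|].
have pa : v p ≤ eval v (big_and l).
  by apply/big_and_glb => f fl; apply: (Hv (LVar p ⊢ f)); left; left; exists f.
have : holds v (seq_map (subst1 p (big_and l)) s).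
  apply: H => r [[t Tht <-]|Th't]; last by apply: Hv; right.
  rewrite holds_subst1 /holds; have [neg pos] := pTh _ Tht.
  apply: le_trans (eval_negative v pa neg) _.
  apply: le_trans (eval_positive v pa pos); rewrite -vE.
  by apply: Hv; left; right.
rewrite holds_subst1; case: ps => [ps|/andP[pos neg]].
  by rewrite holds_upd_fresh.
rewrite /holds => Hs; rewrite vE.
apply: le_trans (eval_positive v pa pos) _.
exact: le_trans Hs (eval_negative v pa neg).
Qed.

Lemma plain_rule_valid S S' : plain_rule S S' -> ss_valid S <-> ss_valid S'.
Proof.
case=> [s B Th t r|Th f g h|Th f g h|l p Th Th' s _|l p Th Th' s _].
- split=> H v /= Hv; apply: H => r' [].
  + by move=> ->; apply/(assumption_rule_holds v r) => r'' Br; apply: Hv; left.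
  + by move=> Tr; apply: Hv; right.
  + move: r'; apply/(assumption_rule_holds v r); apply: Hv; by left.
  + by move=> Tr; apply: Hv; right.
- by split=> H v Hv; apply/imp_adj; apply: H.
- by split=> H v Hv; apply/coimp_adj; apply: H.
- exact: RAck_valid.
- exact: LAck_valid.
Qed.

Lemma fresh_rule_valid p S S' : fresh_rule p S S' -> ~ ss_occurs p S ->
  ss_valid S <-> ss_valid S'.
Proof.
have freshTh (Th : set lc_sequent) v a : ~ set_occurs p Th ->
    (forall t, Th t -> holds v t) -> forall t, Th t -> holds (upd v p a) t.
  move=> pTh Hv t Tht; rewrite holds_upd_fresh; first exact: Hv.
  by apply/negP => pt; apply: pTh; exists t.
case=> [s B Th t r|Th f g|Th f g] pS.
- split=> H v /= Hv.
    apply: H => t' [->|Tt]; last by apply: Hv; right.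
    by apply: (approximation_rule_sound r) => t'' Bt; apply: Hv; left.
  have [||a Ha] := @approximation_rule_complete v _ _ _ r.
  + by apply/negP => ps; apply: pS; left; exists s => //; left.
  + by apply: Hv; left.
  have := H (upd v p a); rewrite /= holds_upd_fresh; last first.
    by apply/negP => pt; apply: pS; right.
  apply=> t' [Bt|Tt]; first exact: Ha.
  apply: (freshTh Th) Tt => [[t'' Tt'' pt]|t'' Tt''].
    by apply: pS; left; exists t'' => //; right.
  by apply: Hv; right.
- have [pTh] : ~ set_occurs p Th /\ ~~ seq_occurs p (f ⊢ g).
    by split; [move=> ?|apply/negP => ?]; apply: pS; [left|right].
  rewrite /seq_occurs negb_or => /andP[/= pf pg].
  split=> H v /= Hv.
    apply: (le_trans (eval v f)); first exact:
      (Hv (LVar p ⊢ f) (or_introl erefl)).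
    by apply: (H v) => t Tt; apply: Hv; right.
  have := H (upd v p (eval v f)).
  rewrite /holds /= upd_eq !eval_upd_fresh //; apply=> t [->|Tt] /=.
    by rewrite upd_eq eval_upd_fresh.
  exact: freshTh Tt.
- have [pTh] : ~ set_occurs p Th /\ ~~ seq_occurs p (f ⊢ g).
    by split; [move=> ?|apply/negP => ?]; apply: pS; [left|right].
  rewrite /seq_occurs negb_or => /andP[/= pf pg].
  split=> H v /= Hv.
    apply: (le_trans (eval v g)); last exact:
      (Hv (g ⊢ LVar p) (or_introl erefl)).
    by apply: (H v) => t Tt; apply: Hv; right.
  have := H (upd v p (eval v g)).
  rewrite /holds /= upd_eq !eval_upd_fresh //; apply=> t [->|Tt] /=.
    by rewrite upd_eq eval_upd_fresh.
  exact: freshTh Tt.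
Qed.

Lemma ALC_derivation_valid S0 D S : ALC_derivation S0 D S ->
  ss_valid S0 <-> ss_valid S.
Proof.
elim=> {D S} [|D S S' _ IH /plain_rule_valid r|D S S' _ IH /plain_rule_valid r
  |p D S S' der IH r fresh|p D S S' _ IH r fresh].
- by [].
- exact: iff_trans IH r.
- exact: iff_trans IH (iff_sym r).
- apply: iff_trans IH (fresh_rule_valid r (fresh _ _)).
  by case: der; intros; left.
- exact: iff_trans IH (iff_sym (fresh_rule_valid r fresh)).
Qed.

Lemma ALC_derives_valid s t : ALC_derives s t ->
  (forall v, holds v s) <-> (forall v, holds v t).
Proof.
case=> D /ALC_derivation_valid H; split=> Hv v.
  by apply: (proj1 H) => // w _; apply: Hv.
by apply: (proj2 H) => // w _; apply: Hv.
Qed.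

Lemma BDFNL_sound (Psi : set bul_sequent) :
  (forall t, Psi t -> forall v, holds v (seq_map lc_of_bul t)) ->
  forall s, BDFNL Psi s -> forall v, holds v s.
Proof.
move=> HPsi s; elim=> {s}; rewrite /holds /=; intros.
- by rewrite !eval_subst; apply: (HPsi s).
- exact: le_refl.
- exact: le_top.
- exact: bot_le.
- exact: meet_join.
- exact: le_trans (meet_l _ _) (H0 v).
- exact: le_trans (meet_r _ _) (H0 v).
- exact: meet_glb.
- exact: join_lub.
- exact: le_trans (H0 v) (join_l _ _).
- exact: le_trans (H0 v) (join_r _ _).
- exact: le_trans (H0 v) (H2 v).
- exact/imp_adj.
- exact/imp_adj.
- exact/coimp_adj.
- exact/coimp_adj.
Qed.

End Algebra.

(** * The embedding of the implicational system *)

Section Lindenbaum.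
Variable Psi : set bul_sequent.

(** Formulas ordered by derivability. *)
Definition fnl_lindenbaum : fnl_algebra.
Proof.
refine (@FnlAlgebra lc_form (fun a b => BDFNL Psi (a ⊢ b))
  LTop LBot LAnd LOr LImp LFus LCoimp _ _ _ _ _ _ _ _ _ _ _ _ _).
- exact: fnl_id.
- by move=> b a c; apply: fnl_cut.
- exact: fnl_top.
- exact: fnl_bot.
- by move=> a b; apply/fnl_andl1/fnl_id.
- by move=> a b; apply/fnl_andl2/fnl_id.
- by move=> a b c; apply: fnl_andr.
- by move=> a b; apply/fnl_orr1/fnl_id.
- by move=> a b; apply/fnl_orr2/fnl_id.
- by move=> a b c; apply: fnl_orl.
- exact: fnl_distr.
- by move=> a b c; split; [apply: fnl_imp_intro|apply: fnl_imp_elim].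
- by move=> a b c; split; [apply: fnl_coimp_intro|apply: fnl_coimp_elim].
Defined.

Lemma eval_lindenbaum v a : @eval fnl_lindenbaum v a = lc_subst v a.
Proof. by elim: a => //= a -> b ->. Qed.

Lemma lc_of_si_subst u a :
  lc_of_si (si_subst u a) = lc_subst (fun p => lc_of_si (u p)) (lc_of_si a).
Proof. by elim: a => //= a -> b ->. Qed.

Lemma S_BDI_BDFNL (Phi : set si_sequent) :
  (forall s, Phi s -> exists2 t, Psi t &
     ALC_derives (seq_map lc_of_si s) (seq_map lc_of_bul t)) ->
  forall s, S_BDI Phi s -> BDFNL Psi (seq_map lc_of_si s).
Proof.
move=> PhiPsi s; elim=> {s}; rewrite /seq_map /=.
- move=> s u /PhiPsi[t Psit /(@ALC_derives_valid fnl_lindenbaum) st].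
  rewrite !lc_of_si_subst -!eval_lindenbaum; apply: (proj2 st) => v.
  by rewrite /holds !eval_lindenbaum; apply: (fnl_ax v Psit).
- by move=> a; apply: fnl_id.
- by move=> a b c; apply: fnl_distr.
- by move=> a; apply: fnl_top.
- by move=> a; apply: fnl_bot.
- by move=> a; apply/fnl_imp_intro/fnl_top.
- by move=> a; apply/fnl_imp_intro/fnl_coimp_elim/fnl_bot.
- move=> a b c; apply/fnl_imp_intro/fnl_andr; apply: fnl_imp_elim.
    exact/fnl_andl1/fnl_id.
  exact/fnl_andl2/fnl_id.
- move=> a b c; apply/fnl_imp_intro/fnl_coimp_elim/fnl_orl;
    apply/fnl_coimp_intro/fnl_imp_elim.
    exact/fnl_andl1/fnl_id.
  exact/fnl_andl2/fnl_id.
- by move=> a b c _ ab; apply: (@imp_mono fnl_lindenbaum) => //; apply: fnl_id.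
- by move=> a b c _ ab; apply: (@imp_mono fnl_lindenbaum) => //; apply: fnl_id.
- by move=> a b c _; apply: fnl_andl1.
- by move=> a b c _; apply: fnl_andl2.
- by move=> a b c _ + _; apply: fnl_andr.
- by move=> a b c _ + _; apply: fnl_orl.
- by move=> a b c _; apply: fnl_orr1.
- by move=> a b c _; apply: fnl_orr2.
- by move=> a b c _ + _; apply: fnl_cut.
Qed.

End Lindenbaum.

(** * Filters, ideals and prime filters of formulas *)

Section Canonical.
Variable Phi : set si_sequent.
Implicit Types (a b c d : si_form) (e : sign).

Local Notation "a ≼ b" := (S_BDI Phi (a ⊢ b)) (at level 70).

(** The derivability order of the sign [e] is derivability or its converse.
    With it, filters are dealt with together with ideals, and joins with
    meets. *)
Definition ord e a b : Prop := if e then a ≼ b else b ≼ a.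
Definition emeet e : si_form -> si_form -> si_form := if e then SAnd else SOr.
Definition etop e : si_form := if e then STop else SBot.

Lemma ord_refl e a : ord e a a.
Proof. by case: e; apply: bdi_id. Qed.
Hint Resolve ord_refl : core.

Lemma ord_trans e b a c : ord e a b -> ord e b c -> ord e a c.
Proof. by case: e => /= h k; [apply: bdi_cut h k|apply: bdi_cut k h]. Qed.

Lemma ord_neg e a b : ord (~~ e) a b <-> ord e b a.
Proof. by case: e. Qed.

Lemma ord_top e a : ord e a (etop e).
Proof. by case: e; [apply: bdi_top|apply: bdi_bot]. Qed.

Lemma emeet_l e a b : ord e (emeet e a b) a.
Proof. by case: e; [apply/bdi_andl1/bdi_id|apply/bdi_orr1/bdi_id]. Qed.

Lemma emeet_r e a b : ord e (emeet e a b) b.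
Proof. by case: e; [apply/bdi_andl2/bdi_id|apply/bdi_orr2/bdi_id]. Qed.

Lemma emeet_glb e a b c : ord e c a -> ord e c b -> ord e c (emeet e a b).
Proof. by case: e; [apply: bdi_andr|apply: bdi_orl]. Qed.

Lemma emeet_mono e a b c d :
  ord e a c -> ord e b d -> ord e (emeet e a b) (emeet e c d).
Proof.
move=> ac bd; apply: emeet_glb; first exact: ord_trans (emeet_l _ _ _) ac.
exact: ord_trans (emeet_r _ _ _) bd.
Qed.

Lemma ejoin_mono e a b c d :
  ord e a c -> ord e b d -> ord e (emeet (~~ e) a b) (emeet (~~ e) c d).
Proof. by move=> /ord_neg ac /ord_neg bd; apply/ord_neg/emeet_mono. Qed.

Lemma imp_ord a b c d : c ≼ a -> b ≼ d -> SImp a b ≼ SImp c d.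
Proof.
move=> ca bd; apply: (bdi_cut (bdi_imp_monor a bd)); exact: bdi_imp_antil.
Qed.

Lemma and_or_distr a b c :
  SAnd (SOr a b) (SOr a c) ≼ SOr a (SAnd b c).
Proof.
apply: bdi_cut (bdi_distr _ _ _ _) _; apply: bdi_orl.
  exact/bdi_andl2/bdi_orr1/bdi_id.
apply: (@bdi_cut _ _ (SAnd c (SOr a b))).
  by apply: bdi_andr; [apply/bdi_andl2/bdi_id|apply/bdi_andl1/bdi_id].
apply: bdi_cut (bdi_distr _ _ _ _) _; apply: bdi_orl.
  exact/bdi_andl2/bdi_orr1/bdi_id.
apply: bdi_orr2; apply: bdi_andr; last exact/bdi_andl1/bdi_id.
exact/bdi_andl2/bdi_id.
Qed.

(** Distributivity for both signs. *)
Lemma emeet_distr e a b c :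
  ord e (emeet e (emeet (~~ e) a b) (emeet (~~ e) a c))
        (emeet (~~ e) a (emeet e b c)).
Proof. by case: e; [apply: and_or_distr|apply: bdi_distr]. Qed.

(** A filter for the sign [+], an ideal for the sign [-]; the whole set of
    formulas is allowed. *)
Record efilter e (F : set si_form) : Prop := EFilter {
  ef_top : F (etop e);
  ef_up : forall a b, F a -> ord e a b -> F b;
  ef_meet : forall a b, F a -> F b -> F (emeet e a b) }.

Lemma efilterT e : efilter e setT.
Proof. by []. Qed.

Lemma efilterI e F G : efilter e F -> efilter e G -> efilter e (F `&` G).
Proof.
move=> fF fG; split.
- by split; apply: ef_top.
- by move=> a b [Fa Ga] ab; split; [apply: ef_up ab|apply: ef_up ab].
- by move=> a b [Fa Ga] [Fb Gb]; split; apply: ef_meet.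
Qed.

(** Prime filters of formulas: the points of the canonical frame. *)
Record point := Point {
  pset :> si_form -> Prop;
  p_filter : efilter true pset;
  p_bot : ~ pset SBot;
  p_or : forall a b, pset (SOr a b) -> pset a \/ pset b }.
Implicit Types x y z : point.

(** The formula [c], with the sign [e], holds at [x]. *)
Definition sat e c x : Prop := if e then x c else ~ x c.

Lemma sat_neg e c x : sat (~~ e) c x <-> ~ sat e c x.
Proof. by case: e; rewrite //= notK. Qed.

Lemma sat_filter e x : efilter e (fun c => sat e c x).
Proof.
case: e => /=; first exact: p_filter.
split=> /=.
- exact: p_bot.
- by move=> a b xa ba xb; apply/xa/(ef_up (p_filter x) xb).
- by move=> a b xa xb /p_or[].
Qed.

Lemma sat_up e a b x : ord e a b -> sat e a x -> sat e b x.
Proof. by move=> ab xa; apply: (ef_up (sat_filter e x) xa). Qed.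

Lemma sat_bot e x : ~ sat e (etop (~~ e)) x.
Proof. exact/sat_neg/(ef_top (sat_filter (~~ e) x)). Qed.

Lemma sat_prime e a b x : sat e (emeet (~~ e) a b) x -> sat e a x \/ sat e b x.
Proof.
move=> xab; apply: contrapT => /not_orP[/sat_neg xa /sat_neg xb].
by have /sat_neg := ef_meet (sat_filter (~~ e) x) xa xb; apply.
Qed.

(** The prime filters that contain [F] for the sign [+], that are disjoint
    from [F] for the sign [-]. *)
Definition clo e (F : set si_form) x : Prop := forall c, F c -> sat e c x.

(** A filter that is maximal among those disjoint from an ideal is prime. *)
Lemma maximal_point (F I : set si_form) (M : set si_form) :
  efilter false I -> efilter true M -> (forall a, M a -> ~ I a) ->
  (forall N, efilter true N -> (forall a, N a -> ~ I a) -> M `<=` N ->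
    N `<=` M) ->
  exists x, pset x = M.
Proof.
move=> fI fM MI maxM.
have bot : ~ M SBot by move=> /MI; apply; apply: (ef_top fI).
have or a b : M (SOr a b) -> M a \/ M b.
  move=> Mab; apply: contrapT => /not_orP[Ma Mb].
  (* The filter generated by [M] and [d] is too large to avoid [I]. *)
  have ext d : ~ M d -> exists m i, [/\ M m, I i & SAnd m d ≼ i].
    move=> Md; apply: contrapT => no.
    apply: Md; apply: (maxM [set c | exists2 m, M m & SAnd m d ≼ c]).
    - split=> /=.
      + by exists STop; [apply: (ef_top fM)|apply: bdi_top].
      + by move=> a' b' [m Mm ma] ab; exists m => //; apply: bdi_cut ma ab.
      + move=> a' b' [m Mm ma] [n Mn nb]; exists (SAnd m n).
          exact: (ef_meet fM).
        apply: bdi_andr.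
          by apply: bdi_cut ma; apply: (@emeet_mono true) => //;
            apply: (@emeet_l true).
        by apply: bdi_cut nb; apply: (@emeet_mono true) => //;
            apply: (@emeet_r true).
    - by move=> c [m Mm mc] Ic; apply: no; exists m, c.
    - by move=> m Mm; exists m => //; apply: (@emeet_l true).
    - by exists STop; [apply: (ef_top fM)|apply: (@emeet_r true)].
  have [m [i [Mm Ii mi]]] := ext a Ma; have [n [j [Mn Ij nj]]] := ext b Mb.
  apply: (MI (SOr i j)); last exact: (ef_meet fI).
  apply: (ef_up fM (ef_meet fM (ef_meet fM Mm Mn) Mab)) => /=.
  apply: bdi_cut (bdi_distr _ _ _ _) _; apply: (@emeet_mono false) => /=.
    by apply: bdi_cut mi; apply: (@emeet_mono true) => //;
            apply: (@emeet_l true).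
  by apply: bdi_cut nj; apply: (@emeet_mono true) => //;
            apply: (@emeet_r true).
by exists (Point fM bot or).
Qed.

Lemma prime_filter (F I : set si_form) : efilter true F -> efilter false I ->
  (forall a, F a -> ~ I a) -> exists x, F `<=` pset x /\ forall a, I a -> ~ x a.
Proof.
move=> fF fI FI.
(* [P] concerns [F `|` Y] because the empty chain must have an upper bound. *)
pose P (Y : set si_form) :=
  efilter true (F `|` Y) /\ forall a, (F `|` Y) a -> ~ I a.
have [|Y [[fY YI] maxY]] := @Zorn_bigcup _ P.
  move=> C CP totC; have CF a Y : C Y -> Y a -> (F `|` Y) a by right.
  split; last first.
    by move=> a [/FI//|[Y CY Ya]]; apply: (proj2 (CP _ CY)); right.
  split.
  - by left; apply: ef_top.
  - move=> a b [Fa|[Y CY Ya]] ab; first by left; apply: ef_up ab.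
    have [Fb|Yb] := ef_up (proj1 (CP _ CY)) (or_intror Ya) ab; first by left.
    by right; exists Y.
  - have cup Y a b : C Y -> (F `|` Y) a -> (F `|` Y) b ->
        (F `|` \bigcup_(X in C) X) (emeet true a b).
      move=> CY Ya Yb; have [|] := ef_meet (proj1 (CP _ CY)) Ya Yb; first by left.
      by right; exists Y.
    move=> a b [Fa|[Y CY Ya]] [Fb|[Z CZ Zb]].
    + by left; apply: ef_meet.
    + by apply: (cup Z) => //; [left|right].
    + by apply: (cup Y) => //; [right|left].
    + have [/(_ _ Ya) ?|/(_ _ Zb) ?] := totC _ _ CY CZ.
        by apply: (cup Z) => //; right.
      by apply: (cup Y) => //; right.
have [|x xE] := @maximal_point F I (F `|` Y) fI fY YI.
  move=> N fN NI FYN a Na; right; apply: contrapT => Ya.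
  apply: (maxY N).
    split; last by move=> /(_ _ Na).
    by move=> b Yb; apply: FYN; right.
  have FN : F `|` N = N by apply/setUidPr => b Fb; apply: FYN; left.
  by rewrite /P FN.
by exists x; rewrite xE; split=> [a Fa|a Ia xa]; [left|apply: (YI a)].
Qed.

(** Separation of a filter from a disjoint ideal, for both signs. *)
Lemma separation e (F J : set si_form) : efilter e F -> efilter (~~ e) J ->
  (forall a, F a -> ~ J a) -> exists x, clo e F x /\ clo (~~ e) J x.
Proof.
case: e => /= fF fJ FJ; first exact: prime_filter.
have [|x [? ?]] := prime_filter fJ fF; last by exists x.
by move=> a Ja Fa; apply: FJ Ja.
Qed.

(** * The canonical frame *)

(** The accessibility relation of the implication. *)
Definition rel x y z : Prop := forall a b, x (SImp a b) -> y a -> z b.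

(** The next three lemmas state that [rel] is topologically closed: a triple
    exists as soon as its closed constraints are compatible. *)
Lemma rel_second x z (F : set si_form) : efilter true F ->
  (forall a d, F a -> x (SImp a d) -> z d) -> exists2 y, F `<=` pset y & rel x y z.
Proof.
move=> fF xz.
have [||y [Fy ys]] := @separation true F
    [set a | exists2 d, ~ z d & x (SImp a d)] fF.
- split=> /=.
  + exists SBot; first exact: p_bot.
    by apply: (ef_up (p_filter x) (ef_top (p_filter x))); apply: bdi_bot_imp.
  + move=> a b [d zd xad] ba; exists d => //; apply: (ef_up (p_filter x) xad).
    exact: bdi_imp_antil.
  + move=> a b [d zd xad] [d' zd' xbd']; exists (SOr d d').
      by move=> /p_or[].
    apply: (ef_up (p_filter x) (ef_meet (p_filter x) xad xbd')) => /=.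
    apply: bdi_cut (bdi_or_imp _ _ _ _); apply: (@emeet_mono true) => /=.
      by apply/bdi_imp_monor/bdi_orr1/bdi_id.
    by apply/bdi_imp_monor/bdi_orr2/bdi_id.
- by move=> a Fa [d zd xad]; apply/zd/(xz a).
exists y => // a b xab ya; apply: contrapT => zb; apply: (ys a) => //.
by exists b.
Qed.

Lemma rel_imp x (F I : set si_form) : efilter true F -> efilter false I ->
  (forall a b, F a -> I b -> ~ x (SImp a b)) ->
  exists y z, [/\ F `<=` pset y, clo false I z & rel x y z].
Proof.
move=> fF fI xFI.
have [||z [Fz Iz]] := @separation true
    [set b | exists2 a, F a & x (SImp a b)] I _ fI.
- split=> /=.
  + exists STop; first exact: (ef_top fF).
    by apply: (ef_up (p_filter x) (ef_top (p_filter x))); apply: bdi_imp_top.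
  + move=> b c [a ya xab] bc; exists a => //; apply: (ef_up (p_filter x) xab).
    exact: bdi_imp_monor.
  + move=> b c [a ya xab] [a' ya' xac]; exists (SAnd a a').
      exact: (ef_meet fF).
    apply: (ef_up (p_filter x) (ef_meet (p_filter x) xab xac)) => /=.
    apply: bdi_cut (bdi_imp_and _ _ _ _); apply: (@emeet_mono true) => /=.
      by apply/bdi_imp_antil/bdi_andl1/bdi_id.
    by apply/bdi_imp_antil/bdi_andl2/bdi_id.
- by move=> b [a ya xab] Ib; apply: (xFI a b).
have [|y Fy xyz] := @rel_second x z F fF; last by exists y, z.
by move=> a d Fa xad; apply: Fz; exists a.
Qed.

Lemma rel_third x y (I : set si_form) : efilter false I ->
  (forall a b, y a -> I b -> ~ x (SImp a b)) ->
  exists2 z, clo false I z & rel x y z.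
Proof.
move=> fI xy; have [y' [z [yy' Iz xyz]]] := rel_imp (p_filter y) fI xy.
by exists z => // a b xab /yy'; apply: xyz.
Qed.

(** Sets of points that are closed under inclusion. *)
Record upset := Upset {
  uset :> point -> Prop;
  up_closed : forall x y, uset x -> pset x `<=` pset y -> uset y }.

Definition upset_top : upset.
Proof. by exists (fun=> True). Defined.

Definition upset_bot : upset.
Proof. by exists (fun=> False). Defined.

Definition upset_meet (U V : upset) : upset.
Proof.
exists (fun x => U x /\ V x) => x y [Ux Vx] xy.
by split; apply: up_closed xy.
Defined.

Definition upset_join (U V : upset) : upset.
Proof.
exists (fun x => U x \/ V x) => x y [Ux|Vx] xy.
  by left; apply: up_closed xy.
by right; apply: up_closed xy.
Defined.

Definition upset_imp (U V : upset) : upset.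
Proof.
exists (fun x => forall y z, rel x y z -> U y -> V z).
move=> x x' Hx xx' y z x'yz; apply: (Hx y z) => a b /xx'; exact: x'yz.
Defined.

(** The first argument of [rel] comes from the second factor, as residuation
    bounds the product of [U] and [upset_imp U W] by [W]. *)
Definition upset_fus (U V : upset) : upset.
Proof.
exists (fun z => exists x y, [/\ rel x y z, U y & V x]).
move=> z z' [x [y [xyz Uy Vx]]] zz'; exists x, y; split=> // a b xab ya.
exact/zz'/(xyz a).
Defined.

Definition upset_coimp (V W : upset) : upset.
Proof.
exists (fun y => forall x z, rel x y z -> W x -> V z).
move=> y y' Hy yy' x z xy'z; apply: (Hy x z) => a b xab /yy'; exact: xy'z.
Defined.

(** The complex algebra of the canonical frame. *)
Definition upset_algebra : fnl_algebra.
Proof.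
refine (@FnlAlgebra upset (fun U V => forall x, U x -> V x)
  upset_top upset_bot upset_meet upset_join upset_imp upset_fus upset_coimp
  _ _ _ _ _ _ _ _ _ _ _ _ _).
- by [].
- by move=> V U W UV VW x /UV; apply: VW.
- by [].
- by [].
- by move=> U V x [].
- by move=> U V x [].
- by move=> U V W WU WV x Wx; split; [apply: WU|apply: WV].
- by move=> U V x; left.
- by move=> U V x; right.
- by move=> U V W UW VW x [/UW|/VW].
- by move=> U V W x [Ux [Vx|Wx]]; [left|right].
- move=> U V W; split=> H x.
    by move=> Vx y z xyz Uy; apply: H; exists x, y.
  by move=> [y [z [yzx Uz Vy]]]; apply: (H y Vy z).
- move=> U V W; split=> H x.
    by move=> Ux y z yxz Vy; apply: H; exists y, x.
  by move=> [y [z [yzx Uz Vy]]]; apply: (H z Uz y).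
Defined.

Implicit Types (v : nat -> upset).

(** The value of an implicational formula in the algebra of upsets. *)
Definition val v a : upset := @eval upset_algebra v (lc_of_si a).

(** The analogue of [sat] for an upset in place of a formula. *)
Definition satv e (U : upset) x : Prop := if e then U x else ~ U x.

Lemma satv_neg e U x : satv (~~ e) U x <-> ~ satv e U x.
Proof. by case: e; rewrite //= notK. Qed.

(** The embedding of formulas into the algebra of upsets. *)
Definition clopen a : upset.
Proof. by exists (fun x => pset x a) => x y xa; apply. Defined.

Lemma truth_lemma (u : nat -> si_form) a x :
  val (clopen \o u) a x <-> x (si_subst u a).
Proof.
elim: a x => [p|||a IHa b IHb|a IHa b IHb|a IHa b IHb] x //=.
- by split=> // _; apply: (ef_top (p_filter x)).
- by split=> // /p_bot.
- split=> [[/IHa xa /IHb xb]|xab]; first exact: (ef_meet (p_filter x)).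
  split; [apply/IHa|apply/IHb]; apply: (ef_up (p_filter x) xab).
    exact: (@emeet_l true).
  exact: (@emeet_r true).
- split=> [[/IHa xa|/IHb xb]|/p_or[/IHa xa|/IHb xb]].
  + apply: (ef_up (p_filter x) xa); exact: (@emeet_l false).
  + apply: (ef_up (p_filter x) xb); exact: (@emeet_r false).
  + by left.
  + by right.
- split=> [H|xab y z xyz /IHa ya]; last by apply/IHb/(xyz _ _ xab).
  apply: contrapT => xab.
  have [|||y [z [ay bz xyz]]] := @rel_imp x [set c | si_subst u a ≼ c]
    [set c | c ≼ si_subst u b].
  + split=> /=; first exact: bdi_top.
      by move=> c d; apply: bdi_cut.
    by move=> c d; apply: bdi_andr.
  + split=> /=; first exact: bdi_bot.
      by move=> c d cb dc; apply: bdi_cut dc cb.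
    by move=> c d; apply: bdi_orl.
  + move=> c d ac db xcd; apply: xab; apply: (ef_up (p_filter x) xcd).
    exact: imp_ord.
  + apply: (bz (si_subst u b)); first exact: bdi_id.
    exact/IHb/(H y z xyz)/IHa/ay/bdi_id.
Qed.

(** * Inductive signed trees *)

Section Inductive.
Variable eps : order_type.
Variable Om : nat -> nat -> Prop.

Fixpoint si_occ (k : nat) a : bool :=
  match a with
  | SVar q => q == k
  | STop | SBot => false
  | SAnd a b | SOr a b | SImp a b => si_occ k a || si_occ k b
  end.

(** The critical leaf [p_i] occurs in the [e]-signed tree of [a]. *)
Fixpoint critleaf e a (i : nat) : bool :=
  match a with
  | SVar q => (q == i) && critical eps e q
  | STop | SBot => false
  | SAnd a b | SOr a b => critleaf e a i || critleaf e b i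
  | SImp a b => critleaf (~~ e) a i || critleaf e b i
  end.

(** No leaf of the [e]-signed tree of [a] is critical. *)
Fixpoint noncrit e a : bool :=
  match a with
  | SVar q => ~~ critical eps e q
  | STop | SBot => true
  | SAnd a b | SOr a b => noncrit e a && noncrit e b
  | SImp a b => noncrit (~~ e) a && noncrit e b
  end.

(** The variables of the side formula [a] are [Om]-below the critical ones of
    the [e]-signed tree of [b]. *)
Definition lower a e b : Prop :=
  forall k i, si_occ k a -> critleaf e b i -> Om k i.

(** Signed trees all of whose critical branches consist of PIA nodes and whose
    SRR nodes satisfy the side conditions of inductive trees. *)
Inductive pia : sign -> si_form -> Prop :=
| pia_noncrit e a : noncrit e a -> pia e a
| pia_var i : pia (eps i) (SVar i)
| pia_and a b : pia true a -> pia true b -> pia true (SAnd a b)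
| pia_or a b : pia false a -> pia false b -> pia false (SOr a b)
| pia_or_l a b : noncrit true b -> lower b true a -> pia true a ->
    pia true (SOr a b)
| pia_or_r a b : noncrit true a -> lower a true b -> pia true b ->
    pia true (SOr a b)
| pia_and_l a b : noncrit false b -> lower b false a -> pia false a ->
    pia false (SAnd a b)
| pia_and_r a b : noncrit false a -> lower a false b -> pia false b ->
    pia false (SAnd a b)
| pia_imp_l a b : noncrit true b -> lower b false a -> pia false a ->
    pia true (SImp a b)
| pia_imp_r a b : noncrit false a -> lower a true b -> pia true b ->
    pia true (SImp a b).

(** PIA trees below a context of Skeleton nodes. *)
Inductive skel : sign -> si_form -> Prop :=
| skel_pia e a : pia e a -> skel e a
| skel_and e a b : skel e a -> skel e b -> skel e (SAnd a b)
| skel_or e a b : skel e a -> skel e b -> skel e (SOr a b)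
| skel_imp a b : skel true a -> skel false b -> skel false (SImp a b).

Lemma critleaf_branch e a i : critleaf e a i ->
  exists l, branch e a l (eps i) i.
Proof.
elim: a e => [q|||a IHa b IHb|a IHa b IHb|a IHa b IHb] e //=.
- by case/andP=> /eqP-> /eqP->; exists [::]; constructor.
all: by case/orP=> [/IHa|/IHb] [l Hl]; eexists; constructor; exact: Hl.
Qed.

Lemma noncritPn e a : ~~ noncrit e a -> exists i, critleaf e a i.
Proof.
elim: a e => [q|||a IHa b IHb|a IHa b IHb|a IHa b IHb] e //=.
- by rewrite negbK => cq; exists q; rewrite eqxx.
all: by rewrite negb_and => /orP[/IHa|/IHb] [i ci]; exists i;
  rewrite ci ?orbT.
Qed.

Lemma si_occ_branch e a k : si_occ k a -> exists l (d : sign), branch e a l d k.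
Proof.
elim: a e => [q|||a IHa b IHb|a IHa b IHb|a IHa b IHb] e //=.
- by move/eqP->; exists [::], e; constructor.
- case/orP=> [/(IHa e)|/(IHb e)] [l [d Hl]]; do 2 eexists; constructor;
    exact: Hl.
- case/orP=> [/(IHa e)|/(IHb e)] [l [d Hl]]; do 2 eexists; constructor;
    exact: Hl.
- case/orP=> [/(IHa (~~ e))|/(IHb e)] [l [d Hl]]; do 2 eexists; constructor;
    exact: Hl.
Qed.

Lemma all_leaves_noncrit e a :
  (forall l (d : sign) k, branch e a l d k -> critical (dual_type eps) d k) ->
  noncrit e a.
Proof.
move=> H; apply: contrapT => /negP/noncritPn[i /critleaf_branch[l /H]].
by rewrite /critical /dual_type; case: (eps i).
Qed.

(** The side condition of inductive trees at the SRR nodes of a branch [l]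
    that ends in [p_i]. *)
Definition side_condition (l : seq branch_node) (i : nat) : Prop :=
  forall l1 n l2, l = l1 ++ n :: l2 -> is_SRR n ->
    forall m (d : sign) k, branch (side_sign n) (side_form n) m d k ->
      critical (dual_type eps) d k /\ Om k i.

Lemma side_condition_cons n l i :
  side_condition (n :: l) i -> side_condition l i.
Proof. by move=> H l1 m l2 lE; apply: (H (n :: l1)); rewrite lE. Qed.

Lemma good_cons n l : good (n :: l) -> good l.
Proof.
case=> P1 [[|m P2] [/= bE pP1 sP2]].
  exists l, [::]; split=> //; by rewrite -bE in pP1; case/andP: pP1.
by case: bE sP2 => _ -> /andP[_ sP2]; exists P1, P2.
Qed.

Lemma good_PIA n l : good (n :: l) -> ~~ is_skeleton n -> all is_PIA (n :: l).
Proof.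
case=> P1 [[|m P2] [/= bE pP1 sP2]] nn; first by move: pP1; rewrite -bE.
by case: bE sP2 nn => -> _ /andP[->].
Qed.

Definition pia_branches e a : Prop := forall l i,
  branch e a l (eps i) i -> all is_PIA l /\ side_condition l i.

Definition skel_branches e a : Prop := forall l i,
  branch e a l (eps i) i -> good l /\ side_condition l i.

(** An SRR node with a critical leaf below one child has no critical leaf
    below the other child. *)
Lemma srr_side e a n : is_SRR n ->
  (forall l i, branch e a l (eps i) i -> side_condition (n :: l) i) ->
  ~~ noncrit e a ->
  noncrit (side_sign n) (side_form n) /\ lower (side_form n) e a.
Proof.
move=> srr H /noncritPn[i /critleaf_branch[l /H al]]; split.
  apply: all_leaves_noncrit => m d k mk.
  by have [] := al [::] n l erefl srr m d k mk.
move=> k j /(@si_occ_branch (side_sign n))[m [d mk]].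
move=> /critleaf_branch[l' /H al'].
by have [] := al' [::] n l' erefl srr m d k mk.
Qed.

Lemma pia_of_branches e a : pia_branches e a -> pia e a.
Proof.
elim: a e => [q|||a IHa b IHb|a IHa b IHb|a IHa b IHb] e H.
- case: (boolP (noncrit e (SVar q))) => [|/= nq]; first exact: pia_noncrit.
  by move: nq; rewrite negbK => /eqP->; apply: pia_var.
- exact: pia_noncrit.
- exact: pia_noncrit.
- have Ha l i : branch e a l (eps i) i ->
      all is_PIA l /\ side_condition (BranchNode e CAnd e b :: l) i.
    by move=> /br_andl-/(_ b)/H[/andP[]].
  have Hb l i : branch e b l (eps i) i ->
      all is_PIA l /\ side_condition (BranchNode e CAnd e a :: l) i.
    by move=> /br_andr-/(_ a)/H[/andP[]].
  have pa : pia e a.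
    by apply: IHa => l i /Ha[? /side_condition_cons].
  have pb : pia e b.
    by apply: IHb => l i /Hb[? /side_condition_cons].
  case: e H Ha Hb pa pb => H Ha Hb pa pb; first exact: pia_and.
  case: (boolP (noncrit false (SAnd a b))); first exact: pia_noncrit.
  rewrite negb_and => /orP[na|nb].
    have [||? ?] := @srr_side _ a (BranchNode false CAnd false b) _ _ na => //.
      by move=> l i /Ha[].
    exact: pia_and_l.
  have [||? ?] := @srr_side _ b (BranchNode false CAnd false a) _ _ nb => //.
    by move=> l i /Hb[].
  exact: pia_and_r.
- have Ha l i : branch e a l (eps i) i ->
      all is_PIA l /\ side_condition (BranchNode e COr e b :: l) i.
    by move=> /br_orl-/(_ b)/H[/andP[]].
  have Hb l i : branch e b l (eps i) i ->
      all is_PIA l /\ side_condition (BranchNode e COr e a :: l) i.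
    by move=> /br_orr-/(_ a)/H[/andP[]].
  have pa : pia e a.
    by apply: IHa => l i /Ha[? /side_condition_cons].
  have pb : pia e b.
    by apply: IHb => l i /Hb[? /side_condition_cons].
  case: e H Ha Hb pa pb => H Ha Hb pa pb; last exact: pia_or.
  case: (boolP (noncrit true (SOr a b))); first exact: pia_noncrit.
  rewrite negb_and => /orP[na|nb].
    have [||? ?] := @srr_side _ a (BranchNode true COr true b) _ _ na => //.
      by move=> l i /Ha[].
    exact: pia_or_l.
  have [||? ?] := @srr_side _ b (BranchNode true COr true a) _ _ nb => //.
    by move=> l i /Hb[].
  exact: pia_or_r.
- have Ha l i : branch (~~ e) a l (eps i) i ->
      all is_PIA (BranchNode e CImp e b :: l) /\
      side_condition (BranchNode e CImp e b :: l) i.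
    by move=> /br_impl-/(_ b)/H[].
  have Hb l i : branch e b l (eps i) i ->
      all is_PIA (BranchNode e CImp (~~ e) a :: l) /\
      side_condition (BranchNode e CImp (~~ e) a :: l) i.
    by move=> /br_impr-/(_ a)/H[].
  have pa : pia (~~ e) a.
    by apply: IHa => l i /Ha[/andP[_ ?] /side_condition_cons].
  have pb : pia e b.
    by apply: IHb => l i /Hb[/andP[_ ?] /side_condition_cons].
  case: (boolP (noncrit e (SImp a b))); first exact: pia_noncrit.
  rewrite negb_and => nab; case: e H Ha Hb pa pb nab => H Ha Hb pa pb.
    case/orP=> [na|nb].
      have [||? ?] := @srr_side _ a (BranchNode true CImp true b) _ _ na => //.
        by move=> l i /Ha[].
      exact: pia_imp_l.
    have [||? ?] := @srr_side _ b (BranchNode true CImp false a) _ _ nb => //.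
      by move=> l i /Hb[].
    exact: pia_imp_r.
  (* A critical branch cannot pass through the non-PIA node -> of sign -. *)
  by case/orP=> /noncritPn[i /critleaf_branch[l]]; [case/Ha|case/Hb].
Qed.

Lemma skel_of_branches e a : skel_branches e a -> skel e a.
Proof.
elim: a e => [q|||a IHa b IHb|a IHa b IHb|a IHa b IHb] e H.
- apply/skel_pia/pia_of_branches => l i Hb; split; last by case: (H _ _ Hb).
  by inversion Hb.
- exact/skel_pia/pia_noncrit.
- exact/skel_pia/pia_noncrit.
- apply: skel_and; [apply: IHa => l i /br_andl-/(_ b)/H
                   |apply: IHb => l i /br_andr-/(_ a)/H];
    by case=> /good_cons ? /side_condition_cons.
- apply: skel_or; [apply: IHa => l i /br_orl-/(_ b)/H
                  |apply: IHb => l i /br_orr-/(_ a)/H];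
    by case=> /good_cons ? /side_condition_cons.
- case: e H => H; last first.
    apply: skel_imp; [apply: IHa => l i /(@br_impl false)-/(_ b)/H
                     |apply: IHb => l i /br_impr-/(_ a)/H];
      by case=> /good_cons ? /side_condition_cons.
  apply/skel_pia/pia_of_branches => l i Hl; have [gl sl] := H _ _ Hl.
  by split=> //; inversion Hl; subst; apply: good_PIA gl _.
Qed.

(** * Valuations approximated by filters and ideals *)

Definition subst := nat -> si_form.
Implicit Types (u uc un : subst) (W : nat -> set si_form).

(** A family of filters (for the variables of order-type [1]) and ideals (for
    the others).  It stands for the valuation with closed, resp. open, upsets
    as values; enlarging the members makes critical leaves harder to satisfy,
    and noncritical ones easier. *)
Definition kval W : Prop := forall i, efilter (eps i) (W i).

(** The closed or open upset that [W] defines at [p_i] is contained in,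
    respectively contains, [v p_i]. *)
Definition below W v : Prop :=
  forall i x, clo (eps i) (W i) x -> satv (eps i) (v i) x.

Definition mem_kval u W : Prop := forall i, W i (u i).

(** [u'] is a closer approximation than [u] at the variables in [D]. *)
Definition finer (D : nat -> Prop) u' u : Prop :=
  forall k, D k -> ord (eps k) (u' k) (u k).

Definition utop : subst := fun i => etop (eps i).
Definition umeet u u' : subst := fun i => emeet (eps i) (u i) (u' i).

Lemma utop_kval W : kval W -> mem_kval utop W.
Proof. by move=> kW i; apply: ef_top. Qed.

Lemma umeet_kval W u u' :
  kval W -> mem_kval u W -> mem_kval u' W -> mem_kval (umeet u u') W.
Proof. by move=> kW Wu Wu' i; apply: ef_meet. Qed.

Lemma umeet_l D u u' : finer D (umeet u u') u.
Proof. by move=> k _; apply: emeet_l. Qed.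

Lemma umeet_r D u u' : finer D (umeet u u') u'.
Proof. by move=> k _; apply: emeet_r. Qed.

Lemma noncrit_mono e a u u' : noncrit e a ->
  finer (fun k => si_occ k a) u' u -> ord e (si_subst u a) (si_subst u' a).
Proof.
elim: a e => [q|||a IHa b IHb|a IHa b IHb|a IHa b IHb] e //=.
- rewrite /critical => nq /(_ q (eqxx q)) uq; apply/ord_neg.
  by have -> : ~~ e = eps q by case: e (eps q) nq => [] [].
- case/andP=> na nb fu.
  have /(IHa _ na) ua : finer (fun k => si_occ k a) u' u.
    by move=> k ka; apply: fu; rewrite ka.
  have /(IHb _ nb) ub : finer (fun k => si_occ k b) u' u.
    by move=> k kb; apply: fu; rewrite kb orbT.
  by case: e {na nb} ua ub => ua ub;
    [apply: (@emeet_mono true)|apply: (@ejoin_mono false)].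
- case/andP=> na nb fu.
  have /(IHa _ na) ua : finer (fun k => si_occ k a) u' u.
    by move=> k ka; apply: fu; rewrite ka.
  have /(IHb _ nb) ub : finer (fun k => si_occ k b) u' u.
    by move=> k kb; apply: fu; rewrite kb orbT.
  by case: e {na nb} ua ub => ua ub;
    [apply: (@ejoin_mono true)|apply: (@emeet_mono false)].
- case/andP=> na nb fu.
  have /(IHa _ na) ua : finer (fun k => si_occ k a) u' u.
    by move=> k ka; apply: fu; rewrite ka.
  have /(IHb _ nb) ub : finer (fun k => si_occ k b) u' u.
    by move=> k kb; apply: fu; rewrite kb orbT.
  by case: e {na nb} ua ub => /= ua ub; apply: imp_ord.
Qed.

Lemma union_filter e (T : subst -> set si_form) W :
  (forall u, efilter e (T u)) ->
  (forall u u', finer setT u' u -> T u `<=` T u') -> kval W ->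
  efilter e [set c | exists2 u, mem_kval u W & T u c].
Proof.
move=> fT aT kW; split=> /=.
- by exists utop; [apply: utop_kval|apply: ef_top].
- by move=> a b [u Wu Ta] ab; exists u => //; apply: ef_up ab.
- move=> a b [u Wu Ta] [u' Wu' Tb]; exists (umeet u u').
    exact: umeet_kval.
  apply: ef_meet => //; first by apply: aT Ta; apply: umeet_l.
  by apply: aT Tb; apply: umeet_r.
Qed.

Lemma noncrit_filter e a W : noncrit e a -> kval W ->
  efilter (~~ e) [set c | exists2 u, mem_kval u W & ord e c (si_subst u a)].
Proof.
move=> na; apply: (@union_filter _ (fun u => [set c | ord e c (si_subst u a)])).
  move=> u; split=> /=.
  - exact/ord_neg/ord_top.
  - by move=> c d ca /ord_neg dc; apply: ord_trans dc ca.
  - by move=> c d ca da; apply/ord_neg/emeet_glb; apply/ord_neg.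
move=> u u' fu c ca; apply: ord_trans ca _; apply: noncrit_mono => //.
by move=> k _; apply: fu.
Qed.

Lemma noncrit_sat e a u u' x : noncrit e a -> finer setT u' u ->
  sat e (si_subst u a) x -> sat e (si_subst u' a) x.
Proof. by move=> na fu; apply/sat_up/noncrit_mono => // k _; apply: fu. Qed.

(** Signed trees without critical leaves are continuous: what holds at [x]
    under [v], or fails there if the sign is [-], already does so under some
    approximation of [v] by formulas. *)
Lemma noncrit_approx W v e a x : kval W -> below W v -> noncrit e a ->
  satv e (val v a) x -> exists2 u, mem_kval u W & sat e (si_subst u a) x.
Proof.
move=> kW Wv.
elim: a e x => [q|||a IHa b IHb|a IHa b IHb|a IHa b IHb] e x /=.
- rewrite /critical => nq vq.
  have qE : eps q = ~~ e by case: e (eps q) nq {vq} => [] [].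
  have : ~ clo (eps q) (W q) x by move=> /Wv; rewrite qE => /satv_neg; apply.
  move=> /existsNP[c /not_implyP[Wc xc]].
  exists (fun k => if k == q then c else etop (eps k)).
    by move=> k; case: eqP => [->//|_]; apply: ef_top.
  by rewrite eqxx; move/sat_neg: xc; rewrite qE negbK.
- move=> _ vx; exists utop; first exact: utop_kval.
  by case: e vx => //= _; apply: (ef_top (p_filter x)).
- move=> _ vx; exists utop; first exact: utop_kval.
  by case: e vx => //= _; apply: p_bot.
- case/andP=> na nb; case: e na nb => na nb /= vab.
    have [/(IHa _ _ na)[u Wu xu] /(IHb _ _ nb)[u' Wu' xu']] := vab.
    exists (umeet u u'); first exact: umeet_kval.
    apply: (ef_meet (p_filter x)); apply: (@noncrit_sat true); try eassumption.
      exact: umeet_l.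
    exact: umeet_r.
  have [/(IHa false _ na)|/(IHb false _ nb)] :
      ~ val v a x \/ ~ val v b x by apply/not_andP.
    case=> u Wu xu; exists u => // xab.
    by apply/xu/(ef_up (p_filter x) xab)/(@emeet_l true).
  case=> u Wu xu; exists u => // xab.
  by apply/xu/(ef_up (p_filter x) xab)/(@emeet_r true).
- case/andP=> na nb; case: e na nb => na nb /= vab.
    have [/(IHa true _ na)|/(IHb true _ nb)] := vab; case=> u Wu xu; exists u => //.
      by apply/(ef_up (p_filter x) xu)/(@emeet_l false).
    by apply/(ef_up (p_filter x) xu)/(@emeet_r false).
  have [/(IHa false _ na)[u Wu xu] /(IHb false _ nb)[u' Wu' xu']] :
    ~ val v a x /\ ~ val v b x by apply/not_orP.
  exists (umeet u u'); first exact: umeet_kval.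
  apply: (ef_meet (sat_filter false x)); apply: (@noncrit_sat false);
    try eassumption.
    exact: umeet_l.
  exact: umeet_r.
- case/andP=> na nb; case: e na nb => na nb /= vab.
    (* The values of [a] generate a filter and those of [b] an ideal; if no
       implication between them were in [x], a triple of [rel] would refute
       the implication at [x]. *)
    apply: contrapT => no.
    have [y [z [Fy Iz xyz]]] : exists y z,
        [/\ [set c | exists2 u, mem_kval u W & ord false c (si_subst u a)]
              `<=` pset y,
            clo false [set c | exists2 u, mem_kval u W
                                 & ord true c (si_subst u b)] z & rel x y z].
      apply: rel_imp.
      + exact: (@noncrit_filter false).
      + exact: (@noncrit_filter true).
      + move=> c d [u Wu ac] [u' Wu' db] xcd; apply: no.
        exists (umeet u u'); first exact: umeet_kval.
        apply: (ef_up (p_filter x) xcd); apply: imp_ord.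
          apply: bdi_cut ac; apply: (noncrit_mono na).
          exact: umeet_l.
        apply: bdi_cut db _; apply: (noncrit_mono nb).
        exact: umeet_r.
    have vay : val v a y.
      apply: contrapT => /(IHa false _ na)[u Wu]; apply; apply: Fy.
      by exists u => //; apply: bdi_id.
    have [u Wu zb] := IHb true _ nb (vab y z xyz vay).
    by apply: (Iz (si_subst u b)) => //; exists u => //; apply: bdi_id.
  have [y [z [xyz ya zb]]] :
      exists y z, [/\ rel x y z, val v a y & ~ val v b z].
    apply: contrapT => no; apply: vab => y z xyz ya; apply: contrapT => zb.
    by apply: no; exists y, z.
  have [u Wu yu] := IHa true _ na ya.
  have [u' Wu' zu'] := IHb false _ nb zb.
  exists (umeet u u'); first exact: umeet_kval.
  move=> xab.
  have := @noncrit_sat false b _ _ _ nb (@umeet_r _ u u') zu'; apply.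
  apply: (xyz _ _ xab).
  exact: (@noncrit_sat true a _ _ _ na (@umeet_l _ u u') yu).
Qed.

(** * Minimal valuations *)

(** Substitution that distinguishes the critical leaves of a signed tree from
    the noncritical ones. *)
Fixpoint subst2 e a uc un : si_form :=
  match a with
  | SVar q => if critical eps e q then uc q else un q
  | STop => STop
  | SBot => SBot
  | SAnd a b => SAnd (subst2 e a uc un) (subst2 e b uc un)
  | SOr a b => SOr (subst2 e a uc un) (subst2 e b uc un)
  | SImp a b => SImp (subst2 (~~ e) a uc un) (subst2 e b uc un)
  end.

Lemma subst2_noncrit e a uc un :
  noncrit e a -> subst2 e a uc un = si_subst un a.
Proof.
elim: a e => [q|||a IHa b IHb|a IHa b IHb|a IHa b IHb] e //=.
- by move/negbTE->.
all: by case/andP=> /IHa-> /IHb->.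
Qed.

Lemma subst2_diag e a u : subst2 e a u u = si_subst u a.
Proof.
elim: a e => [q|||a IHa b IHb|a IHa b IHb|a IHa b IHb] e //=.
- by case: ifP.
all: by rewrite IHa IHb.
Qed.

(** A demand [P] on the substitutions for critical and noncritical leaves is
    met by [C] and [G] when the noncritical part is to satisfy [C] and the
    value for the critical [p_i] is to be taken from [G un i], which depends on
    variables below [p_i] only.  Along the approximations of [v], [G] defines
    the minimal valuation for the demand, and [solves_sound] says that it is
    below [v]. *)
Record solves v (P : subst -> subst -> Prop)
    (C : subst -> Prop) (G : subst -> nat -> set si_form) (N : nat) : Prop :=
  Solves {
  solves_meets : forall uc un, C un -> (forall i, G un i (uc i)) -> P uc un;
  solves_C : forall u u', finer setT u' u -> C u -> C u';
  solves_G : forall u u' i, finer (Om^~ i) u' u -> G u i `<=` G u' i;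
  solves_filter : forall u i, efilter (eps i) (G u i);
  solves_bound : forall u i, N <= i -> G u i = setT;
  solves_approx : forall W, kval W -> below W v -> exists2 u, mem_kval u W & C u;
  solves_sound : forall W, kval W -> below W v -> forall i x,
    clo (eps i) [set c | exists2 u, mem_kval u W & G u i c] x ->
    satv (eps i) (v i) x }.

Definition solvable v P : Prop := exists C G N, solves v P C G N.

Lemma solvable_impl v (P Q : subst -> subst -> Prop) :
  (forall uc un, P uc un -> Q uc un) -> solvable v P -> solvable v Q.
Proof.
move=> PQ [C [G [N []]]] H *; exists C, G, N; split=> // uc un Cu Gu.
exact/PQ/H.
Qed.

Lemma clo_setT e x : ~ clo e setT x.
Proof. by move=> /(_ (etop (~~ e)) Logic.I)/sat_bot. Qed.

Lemma solvable_and v (P Q : subst -> subst -> Prop) :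
  solvable v P -> solvable v Q -> solvable v (fun uc un => P uc un /\ Q uc un).
Proof.
move=> [C [G [N S]]] [C' [G' [N' S']]].
exists (fun u => C u /\ C' u), (fun u i => G u i `&` G' u i), (maxn N N'); split.
- move=> uc un [Cu Cu'] Gu; split.
    by apply: (solves_meets S) => // i; case: (Gu i).
  by apply: (solves_meets S') => // i; case: (Gu i).
- by move=> u u' fu [Cu Cu']; split;
    [apply: (solves_C S) Cu|apply: (solves_C S') Cu'].
- by move=> u u' i fu c [Gc Gc']; split;
    [apply: (solves_G S) Gc|apply: (solves_G S') Gc'].
- by move=> u i; apply: efilterI; [apply: (solves_filter S)|apply: (solves_filter S')].
- move=> u i; rewrite geq_max => /andP[Ni N'i].
  by rewrite (solves_bound S) // (solves_bound S') // setIT.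
- move=> W kW Wv; have [u Wu Cu] := solves_approx S kW Wv.
  have [u' Wu' Cu'] := solves_approx S' kW Wv.
  exists (umeet u u'); first exact: umeet_kval.
  by split; [apply: (solves_C S) Cu; apply: umeet_l
            |apply: (solves_C S') Cu'; apply: umeet_r].
- move=> W kW Wv i x cl; apply: contrapT => vx.
  have [c /not_implyP[[u Wu Gc] xc]] : exists c,
      ~ ([set c | exists2 u, mem_kval u W & G u i c] c -> sat (eps i) c x).
    by apply/existsNP => cG; apply/vx/(solves_sound S kW Wv).
  have [c' /not_implyP[[u' Wu' Gc'] xc']] : exists c,
      ~ ([set c | exists2 u, mem_kval u W & G' u i c] c -> sat (eps i) c x).
    by apply/existsNP => cG; apply/vx/(solves_sound S' kW Wv).
  have [] : sat (eps i) c x \/ sat (eps i) c' x; [apply: sat_prime|by []|by []].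
  apply: cl; exists (umeet u u'); first exact: umeet_kval.
  split.
    apply: (ef_up (solves_filter S _ _) (a := c)).
      by apply: (solves_G S) Gc; apply: umeet_l.
    by apply/ord_neg; apply: emeet_l.
  apply: (ef_up (solves_filter S' _ _) (a := c')).
    by apply: (solves_G S') Gc'; apply: umeet_r.
  by apply/ord_neg; apply: emeet_r.
Qed.

(** A family [T] of filters (for the sign [+]) or ideals (for [-]) that depends
    on variables in [D] and has the property that [a] holds for [v] on the
    closed set of points that [T] defines along the approximations of [v]. *)
Record source v e a (T : subst -> set si_form) (D : nat -> Prop) : Prop :=
  Source {
  src_filter : forall u, efilter e (T u);
  src_mono : forall u u', finer D u' u -> T u `<=` T u';
  src_sound : forall W, kval W -> below W v -> forall x,
    clo e [set c | exists2 u, mem_kval u W & T u c] x -> satv e (val v a) x }.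

(** A monotone context [f u], with noncritical parameters, is moved from the
    formula to the family; this is residuation at an SRR node. *)
Lemma source_residual v e e' a b T D (f : subst -> si_form -> si_form)
    (Df : nat -> Prop) :
  source v e a T D ->
  (forall u c d, ord e' c d -> ord e (f u c) (f u d)) ->
  (forall u u' c, finer Df u' u -> ord e (f u c) (f u' c)) ->
  (forall u, ord e (etop e) (f u (etop e'))) ->
  (forall u c d, ord e (emeet e (f u c) (f u d)) (f u (emeet e' c d))) ->
  (forall W, kval W -> below W v -> forall x y, satv e (val v a) x ->
     (forall u d, mem_kval u W -> sat e (f u d) x -> sat e' d y) ->
     satv e' (val v b) y) ->
  source v e' b (fun u => [set d | T u (f u d)]) (fun k => D k \/ Df k).
Proof.
move=> [fT aT sT] f_mono f_anti f_top f_meet f_val; split.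
- move=> u; split=> /=.
  + exact: ef_up (ef_top (fT u)) (f_top u).
  + by move=> c d Tc cd; apply: ef_up Tc (f_mono _ _ _ cd).
  + by move=> c d Tc Td; apply: ef_up (ef_meet (fT u) Tc Td) (f_meet _ _ _).
- move=> u u' fu d /= Td.
  apply: (ef_up (fT u') (a := f u d)).
    by apply: aT Td => k Dk; apply: fu; left.
  by apply: f_anti => k Dk; apply: fu; right.
- move=> W kW Wv y cl.
  (* If no member of [J] holds, with the sign [e], at a point, then [f u d] fails
     there whenever [d] fails, with the sign [e'], at [y]. *)
  pose J := [set c | exists u d,
    [/\ mem_kval u W, ~ sat e' d y & ord e c (f u d)]].
  have aT' u u' : finer setT u' u -> T u `<=` T u'.
    by move=> fu; apply: aT => k _; apply: fu.
  have f_anti' u u' c : finer setT u' u -> ord e (f u c) (f u' c).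
    by move=> fu; apply: f_anti => k _; apply: fu.
  have fJ : efilter (~~ e) J.
    split=> /=.
    + exists utop, (etop (~~ e')); split; first exact: utop_kval.
        exact: sat_bot.
      exact/ord_neg/ord_top.
    + move=> c c' [u [d [Wu yd cd]]] /ord_neg c'c; exists u, d; split=> //.
      exact: ord_trans c'c cd.
    + move=> c c' [u [d [Wu yd cd]]] [u' [d' [Wu' yd' cd']]].
      exists (umeet u u'), (emeet (~~ e') d d'); split.
      * exact: umeet_kval.
      * by case/sat_prime.
      * apply/ord_neg/emeet_glb; apply/ord_neg.
          apply: ord_trans cd _; apply: ord_trans (f_anti' _ _ _ (@umeet_l _ u u')) _.
          by apply: f_mono; apply/ord_neg/emeet_l.
        apply: ord_trans cd' _; apply: ord_trans (f_anti' _ _ _ (@umeet_r _ u u')) _.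
        by apply: f_mono; apply/ord_neg/emeet_r.
  have [c [u Wu Tc] [u' [d [Wu' yd cd]]]|x [Tx Jx]] :=
      separation (union_filter fT aT' kW) fJ.
    apply: yd; apply: cl; exists (umeet u u'); first exact: umeet_kval.
    apply: (ef_up (fT _) (a := c)); first by apply: aT' Tc; apply: umeet_l.
    by apply: ord_trans cd _; apply: f_anti'; apply: umeet_r.
  apply: (f_val W kW Wv x); first exact: (sT W kW Wv).
  move=> u d Wu xd; apply: contrapT => yd.
  have /sat_neg : sat (~~ e) (f u d) x by apply: Jx; exists u, d.
  exact.
Qed.

(** Without critical leaves there is nothing to bound; compactness turns the
    property of [T] into a condition on one approximation. *)
Lemma solvable_noncrit v e a T D : noncrit e a -> source v e a T D ->
  solvable v (fun uc un => T un (subst2 e a uc un)).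
Proof.
move=> na [fT aT sT].
have aT' u u' : finer setT u' u -> T u `<=` T u'.
  by move=> fu; apply: aT => k _; apply: fu.
exists (fun u => T u (si_subst u a)), (fun _ _ => setT), 0; split.
- by move=> uc un Tu _; rewrite subst2_noncrit.
- move=> u u' fu Tu; apply: (ef_up (fT u') (aT' _ _ fu _ Tu)).
  by apply: noncrit_mono => // k _; apply: fu.
- by [].
- by move=> _ i; apply: efilterT.
- by [].
- move=> W kW Wv; apply: contrapT => no.
  have [c [u Wu Tc] [u' Wu' ca]|x [Tx Jx]] :=
      separation (union_filter fT aT' kW) (noncrit_filter na kW).
    apply: no; exists (umeet u u'); first exact: umeet_kval.
    apply: (ef_up (fT _) (a := c)); first by apply: aT' Tc; apply: umeet_l.
    by apply: ord_trans ca _; apply: noncrit_mono na _; apply: umeet_r.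
  have [u Wu xu] := noncrit_approx kW Wv na (sT W kW Wv x Tx).
  have /sat_neg : sat (~~ e) (si_subst u a) x.
    by apply: Jx; exists u.
  exact.
- move=> W kW _ i x cl; exfalso; apply: (@clo_setT (eps i) x) => c _.
  by apply: cl; exists utop => //; apply: utop_kval.
Qed.

(** At a critical leaf, the family [T] itself is the bound. *)
Lemma solvable_var v i T D : (forall k, D k -> Om k i) ->
  source v (eps i) (SVar i) T D ->
  solvable v (fun uc un => T un (subst2 (eps i) (SVar i) uc un)).
Proof.
move=> Di [fT aT sT].
exists setT, (fun u j => if j == i then T u else setT), i.+1; split.
- by move=> uc un _ /(_ i); rewrite /= /critical !eqxx.
- by [].
- move=> u u' j; case: eqP => // -> fu; apply: aT => k Dk.
  exact/fu/Di.
- by move=> u j; case: eqP => // ->.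
- by move=> u j; case: eqP => // ->; rewrite ltnn.
- by move=> W kW _; exists utop => //; apply: utop_kval.
- move=> W kW Wv j x; case: eqP => [->|_ cl]; first exact: (sT W kW Wv).
  exfalso; apply: (@clo_setT (eps j) x) => c _.
  by apply: cl; exists utop => //; apply: utop_kval.
Qed.

Lemma satv_up e (U : upset) x y :
  (forall d, sat e d x -> sat e d y) -> satv e U x -> satv e U y.
Proof.
case: e => /= xy Ux; first exact: up_closed Ux xy.
move=> Uy; apply/Ux/(up_closed Uy) => d yd; apply: contrapT => xd.
exact: xy xd yd.
Qed.

(** Residuation at [+∨] and [-∧], where [b] is the side formula. *)
Lemma source_lattice v e a b c T D : noncrit e b ->
  (forall x, satv e (val v a) x -> satv e (val v b) x \/ satv e (val v c) x) ->
  source v e a T D ->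
  source v e c (fun u => [set d | T u (emeet (~~ e) (si_subst u b) d)])
    (fun k => D k \/ si_occ k b).
Proof.
move=> nb abc sa.
apply: (source_residual (f := fun u d => emeet (~~ e) (si_subst u b) d)) sa _ _ _ _ _.
- by move=> u d d' dd'; apply: ejoin_mono.
- by move=> u u' d fu; apply: ejoin_mono => //; apply: noncrit_mono.
- by move=> u; apply/ord_neg/emeet_r.
- by move=> u d d'; apply: emeet_distr.
move=> W kW Wv x y /abc xbc xy; case: xbc => [xb|].
  have [u Wu xu] := noncrit_approx kW Wv nb xb.
  have [] := @sat_bot e y; apply: (xy u) => //.
  by apply: sat_up xu; apply/ord_neg/emeet_l.
apply: satv_up => d xd; apply: (xy utop); first exact: utop_kval.
by apply: sat_up xd; apply/ord_neg/emeet_r.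
Qed.

Lemma source_imp_l v a b T D : noncrit true b ->
  source v true (SImp a b) T D ->
  source v false a (fun u => [set d | T u (SImp d (si_subst u b))])
    (fun k => D k \/ si_occ k b).
Proof.
move=> nb sa.
apply: (source_residual (f := fun u d => SImp d (si_subst u b))) sa _ _ _ _ _.
- by move=> u d d'; apply: bdi_imp_antil.
- by move=> u u' d fu; apply: bdi_imp_monor; apply: (noncrit_mono nb).
- by move=> u; apply: bdi_bot_imp.
- by move=> u d d'; apply: bdi_or_imp.
move=> W kW Wv x y /= xab xy ya.
have [c d yc [u Wu db] xcd|z Iz xyz] :=
    rel_third (x := x) (y := y) (noncrit_filter nb kW).
  apply: (xy u c Wu) yc; apply: (ef_up (p_filter x) xcd); exact: bdi_imp_monor.
have [u Wu zb] := noncrit_approx kW Wv nb (xab y z xyz ya : satv true _ z).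
by apply: (Iz (si_subst u b)) => //; exists u.
Qed.

Lemma source_imp_r v a b T D : noncrit false a ->
  source v true (SImp a b) T D ->
  source v true b (fun u => [set d | T u (SImp (si_subst u a) d)])
    (fun k => D k \/ si_occ k a).
Proof.
move=> na sa.
apply: (source_residual (f := fun u d => SImp (si_subst u a) d)) sa _ _ _ _ _.
- by move=> u d d'; apply: bdi_imp_monor.
- by move=> u u' d fu; apply: bdi_imp_antil; apply: (noncrit_mono na).
- by move=> u; apply: bdi_imp_top.
- by move=> u d d'; apply: bdi_imp_and.
move=> W kW Wv x z /= xab xz.
have [c d [u Wu ac] xcd|y Fy xyz] :=
    rel_second (x := x) (z := z) (noncrit_filter na kW).
  apply: (xz u) => //; apply: (ef_up (p_filter x) xcd); exact: bdi_imp_antil.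
apply: (xab y z xyz); apply: contrapT => ya.
have [u Wu] := noncrit_approx kW Wv na (ya : satv false _ y).
by apply; apply: Fy; exists u.
Qed.

(** The variables in [D], on which [T] depends, must lie below all critical
    variables of [a]. *)
Lemma solvable_pia v e a T D : pia e a ->
  (forall k i, D k -> critleaf e a i -> Om k i) -> source v e a T D ->
  solvable v (fun uc un => T un (subst2 e a uc un)).
Proof.
move=> pa; elim: pa T D => {e a}.
- by move=> e a na T D _; apply: solvable_noncrit.
- move=> i T D Di; apply: solvable_var => k Dk; apply: Di => //=.
  by rewrite /critical !eqxx.
- move=> a b _ IHa _ IHb T D lD sab; have [fT aT sT] := sab.
  have sa : source v true a T D.
    by split=> // W kW Wv x Tx; case: (sT W kW Wv x Tx).
  have sb : source v true b T D.
    by split=> // W kW Wv x Tx; case: (sT W kW Wv x Tx).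
  apply: (solvable_impl _ (solvable_and (IHa T D _ sa) (IHb T D _ sb))).
  + by move=> uc un [Ta Tb]; apply: (ef_meet (fT un)).
  + by move=> k i Dk ai; apply: lD => //=; rewrite ai.
  + by move=> k i Dk bi; apply: lD => //=; rewrite bi orbT.
- move=> a b _ IHa _ IHb T D lD sab; have [fT aT sT] := sab.
  have sa : source v false a T D.
    by split=> // W kW Wv x Tx xa; apply: (sT W kW Wv x Tx); left.
  have sb : source v false b T D.
    by split=> // W kW Wv x Tx xb; apply: (sT W kW Wv x Tx); right.
  apply: (solvable_impl _ (solvable_and (IHa T D _ sa) (IHb T D _ sb))).
  + by move=> uc un [Ta Tb]; apply: (ef_meet (fT un)).
  + by move=> k i Dk ai; apply: lD => //=; rewrite ai.
  + by move=> k i Dk bi; apply: lD => //=; rewrite bi orbT.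
- move=> a b nb lb _ IHa T D lD sab.
  have sa := source_lattice (c := a) nb _ sab.
  apply: (solvable_impl _ (IHa _ _ _ (sa _))).
  + move=> uc un /= Tab; rewrite (subst2_noncrit _ _ nb).
    apply: (ef_up (src_filter sab un) Tab); apply: bdi_orl.
      exact/bdi_orr2/bdi_id.
    exact/bdi_orr1/bdi_id.
  + by move=> k i [Dk|kb] ai; [apply: lD; rewrite /= ?ai|apply: lb].
  + by move=> x [xa|xb]; [right|left].
- move=> a b na la _ IHb T D lD sab.
  have sb := source_lattice (c := b) na _ sab.
  apply: (solvable_impl _ (IHb _ _ _ (sb _))).
  + by move=> uc un /= Tab; rewrite (subst2_noncrit _ _ na).
  + by move=> k i [Dk|ka] bi; [apply: lD; rewrite /= ?bi ?orbT|apply: la].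
  + by move=> x [xa|xb]; [left|right].
- move=> a b nb lb _ IHa T D lD sab.
  have sa := source_lattice (c := a) nb _ sab.
  apply: (solvable_impl _ (IHa _ _ _ (sa _))).
  + move=> uc un /= Tab; rewrite (subst2_noncrit _ _ nb).
    apply: (ef_up (src_filter sab un) Tab); apply: bdi_andr.
      exact/bdi_andl2/bdi_id.
    exact/bdi_andl1/bdi_id.
  + by move=> k i [Dk|kb] ai; [apply: lD; rewrite /= ?ai|apply: lb].
  + by move=> x /= /not_andP[xa|xb]; [right|left].
- move=> a b na la _ IHb T D lD sab.
  have sb := source_lattice (c := b) na _ sab.
  apply: (solvable_impl _ (IHb _ _ _ (sb _))).
  + by move=> uc un /= Tab; rewrite (subst2_noncrit _ _ na).
  + by move=> k i [Dk|ka] bi; [apply: lD; rewrite /= ?bi ?orbT|apply: la].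
  + by move=> x /= /not_andP[xa|xb]; [left|right].
- move=> a b nb lb _ IHa T D lD sab.
  apply: (solvable_impl _ (IHa _ _ _ (source_imp_l nb sab))).
  + by move=> uc un /= Tab; rewrite (subst2_noncrit _ _ nb).
  + by move=> k i [Dk|kb] ai; [apply: lD; rewrite /= ?ai|apply: lb].
- move=> a b na la _ IHb T D lD sab.
  apply: (solvable_impl _ (IHb _ _ _ (source_imp_r na sab))).
  + by move=> uc un /= Tab; rewrite (subst2_noncrit _ _ na).
  + by move=> k i [Dk|ka] bi; [apply: lD; rewrite /= ?bi ?orbT|apply: la].
Qed.

Lemma solvable_skel v e a x : skel e a -> satv e (val v a) x ->
  solvable v (fun uc un => sat e (subst2 e a uc un) x).
Proof.
move=> sa; elim: sa x => {e a}.
- move=> e a pa x xa.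
  apply: (@solvable_pia v e a (fun _ c => sat e c x) (fun _ => False)) => //.
  split=> [u|u u' _|W kW Wv y cl]; [exact: sat_filter|by []|].
  apply: satv_up xa => d xd; apply: cl; exists utop => //; exact: utop_kval.
- move=> e a b _ IHa _ IHb x; case: e IHa IHb => IHa IHb /=.
    case=> /IHa sa /IHb sb; apply: solvable_impl (solvable_and sa sb).
    by move=> uc un [/= xa xb]; apply: (ef_meet (p_filter x)).
  move=> /not_andP[/IHa|/IHb]; apply: solvable_impl => uc un; apply: sat_up.
    exact: (@emeet_l true).
  exact: (@emeet_r true).
- move=> e a b _ IHa _ IHb x; case: e IHa IHb => IHa IHb /=.
    case=> [/IHa|/IHb]; apply: solvable_impl => uc un.
      by apply: (@sat_up true); apply: (@emeet_l false).
    by apply: (@sat_up true); apply: (@emeet_r false).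
  move=> /not_orP[/IHa sa /IHb sb]; apply: solvable_impl (solvable_and sa sb).
  by move=> uc un [/= xa xb]; apply: (ef_meet (sat_filter false x)).
- move=> a b _ IHa _ IHb x /= xab.
  have [y [z [xyz /IHa sa /IHb sb]]] :
      exists y z, [/\ rel x y z, satv true (val v a) y & satv false (val v b) z].
    apply: contrapT => no; apply: xab => y z xyz ya; apply: contrapT => zb.
    by apply: no; exists y, z.
  apply: solvable_impl (solvable_and sa sb) => uc un [/= ya zb] xab'.
  exact/zb/(xyz _ _ xab').
Qed.

(** * Canonicity *)

(** The minimal valuation that [G] defines by recursion along [Om]. *)
Inductive minval (G : subst -> nat -> set si_form) : nat -> si_form -> Prop :=
| MinVal i c u : (forall k, Om k i -> minval G k (u k)) -> G u i c ->
    minval G i c.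

Lemma minvalE G i c : minval G i c <->
  exists2 u, (forall k, Om k i -> minval G k (u k)) & G u i c.
Proof.
split=> [[j d u Gu Gd]|[u Gu Gc]]; first by exists u.
exact: MinVal Gu Gc.
Qed.

Lemma minval_approx v P C G N (rank : nat -> nat) : solves v P C G N ->
  (forall k i, Om k i -> rank k < rank i) ->
  kval (minval G) /\ below (minval G) v.
Proof.
move=> S Omr.
suff H n i : rank i < n -> efilter (eps i) (minval G i) /\
    forall x, clo (eps i) (minval G i) x -> satv (eps i) (v i) x.
  by split=> i; have [] := H _ i (ltnSn _).
elim: n i => // n IH i rin.
have {}IH k : Om k i -> efilter (eps k) (minval G k) /\
    forall x, clo (eps k) (minval G k) x -> satv (eps k) (v k) x.
  by move=> /Omr rki; apply: IH; apply: leq_trans rki rin.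
(* [W] is [minval G] below [i] and imposes no bound elsewhere. *)
pose W k := [set c | Om k i -> minval G k c].
have kW : kval W.
  move=> k; split=> /=.
  - by move=> /IH[/ef_top].
  - by move=> c d Wc cd ki; apply: (ef_up (proj1 (IH _ ki)) (Wc ki) cd).
  - move=> c d Wc Wd ki.
    by apply: (ef_meet (proj1 (IH _ ki))); [apply: Wc|apply: Wd].
have Wv : below W v.
  move=> k x cl; have [ki|ki] := pselect (Om k i).
    by apply: (proj2 (IH k ki)) => c Gc; apply: cl.
  by have /sat_bot : sat (eps k) (etop (~~ eps k)) x by apply: cl.
have -> : minval G i = [set c | exists2 u, mem_kval u W & G u i c].
  by apply/seteqP; split=> c /minvalE.
split; last exact: (solves_sound S kW Wv).
apply: (union_filter (T := G^~ i)) kW => [u|u u' fu].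
  exact: (solves_filter S).
by apply: (solves_G S) => k _; apply: fu.
Qed.

(** One substitution can serve for the critical and the noncritical leaves: its
    values are chosen in the minimal valuation, from the [Om]-largest variables
    down, each time refining the values at the smaller ones. *)
Lemma solvable_diag v P (rank : nat -> nat) : solvable v P ->
  (forall k i, Om k i -> rank k < rank i) -> exists u, P u u.
Proof.
move=> [C [G [N S]]] Omr; have [kW Wv] := minval_approx S Omr.
have step l : sorted (relpre rank leq) l -> exists u,
    [/\ mem_kval u (minval G), C u & forall i, i \in l -> G u i (u i)].
  elim: l => [_|i l IH] /=.
    by have [u Wu Cu] := solves_approx S kW Wv; exists u.
  rewrite path_sortedE; last by move=> ? ? ?; apply: leq_trans.
  case/andP=> /allP il /IH[u [Wu Cu Gu]].
  have [u' Wu' Gu'] : exists2 u',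
      (forall k, Om k i -> minval G k (u' k)) & G u' i (u i).
    exact/minvalE.
  pose w k := if `[<Om k i>] then emeet (eps k) (u k) (u' k) else u k.
  have wu : finer setT w u.
    by move=> k _; rewrite /w; case: ifP => // _; apply: emeet_l.
  have wE j : rank i <= rank j -> w j = u j.
    by move=> ij; rewrite /w; case: asboolP => // /Omr; rewrite ltnNge ij.
  exists w; split.
  - move=> k; rewrite /w; case: asboolP => // ki.
    by apply: (ef_meet (kW k)) => //; apply: Wu'.
  - exact: (solves_C S) Cu.
  - move=> j; rewrite inE => /orP[/eqP->|jl]; rewrite wE //.
    + apply: (solves_G S) Gu' => k ki; rewrite /w asboolT //.
      exact: emeet_r.
    + apply: (solves_G S) (Gu j jl) => k _; exact: wu.
    + exact: il.
have [|u [Wu Cu Gu]] := step (sort (relpre rank leq) (iota 0 N)).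
  by apply: sort_sorted => i j; apply: leq_total.
exists u; apply: (solves_meets S) => // i; case: (ltnP i N) => [iN|Ni].
  by apply: Gu; rewrite mem_sort mem_iota.
by rewrite (solves_bound S).
Qed.

End Inductive.

Lemma branch_occ e a l (d : sign) k : branch e a l d k -> si_occ k a.
Proof.
by elim=> [e0 i|||||| ] //=; try move=> e0 b c m d0 i _ ->; rewrite ?eqxx ?orbT.
Qed.

Lemma branch_side_occ e a l (d : sign) i l1 n l2 k : branch e a l d i ->
  l = l1 ++ n :: l2 -> si_occ k (side_form n) -> si_occ k a.
Proof.
move=> al; elim: al l1 => {e a l d i} [e i [] //|||||| ] e b c l d i _ IH;
  case=> [|m l1] /= [].
all: by [move=> <- _ /= ->; rewrite ?orbT
        |move=> _ lE /(IH _ lE) ->; rewrite ?orbT].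
Qed.

Lemma si_occ_bound a : exists N, forall k, si_occ k a -> k < N.
Proof.
elim: a => [q|||a [N HN] b [M HM]|a [N HN] b [M HM]|a [N HN] b [M HM]] /=.
- by exists q.+1 => k /eqP->.
- by exists 0.
- by exists 0.
all: by exists (maxn N M) => k /orP[/HN|/HM] kN; rewrite leq_max kN ?orbT.
Qed.

(** Restricting the order to finitely many variables makes it well-founded. *)
Lemma rank_exists (Omega : nat -> nat -> Prop) N : StrictOrder Omega ->
  exists rank : nat -> nat,
    forall k i, k < N /\ Omega k i -> rank k < rank i.
Proof.
move=> [irr tr]; exists (fun i => #|[set k : 'I_N | `[< Omega k i >] ]%SET|).
move=> k i [kN ki]; apply/proper_card/properP; split.
  apply/fintype.subsetP => j; rewrite !finset.inE => /asboolP jk.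
  by apply/asboolP; apply: tr jk ki.
exists (Ordinal kN); rewrite !finset.inE /=; first exact/asboolP.
by apply/asboolP => /irr.
Qed.

Lemma inductive_tree_skel (Omega : nat -> nat -> Prop) eps e a N :
  (forall k, si_occ k a -> k < N) -> inductive_tree Omega eps e a ->
  skel eps (fun k i => k < N /\ Omega k i) e a.
Proof.
move=> aN ind; apply: skel_of_branches => l i al.
have [gl sl] := ind _ _ _ al (eqxx _); split=> // l1 n l2 lE srr m d k mk.
have [dk ki] := sl l1 n l2 lE srr m d k mk; split=> //; split=> //.
exact/aN/(branch_side_occ al lE)/(branch_occ mk).
Qed.

(** Canonicity of inductive sequents: if all instances of [s] are derivable,
    then [s] holds in the algebra of all upsets. *)
Lemma inductive_canonical s : inductive_sequent s ->
  (forall u, S_BDI Phi (seq_map (si_subst u) s)) ->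
  forall v x, val v (lhs s) x -> val v (rhs s) x.
Proof.
move=> [Omega [eps [ord indl indr]]] der v x xl; apply: contrapT => xr.
have [N HN] := si_occ_bound (SAnd (lhs s) (rhs s)).
have [rank Hrank] := rank_exists N ord.
have sl : skel eps (fun k i => k < N /\ Omega k i) true (lhs s).
  by apply: inductive_tree_skel indl => k kl; apply: HN; rewrite /= kl.
have sr : skel eps (fun k i => k < N /\ Omega k i) false (rhs s).
  by apply: inductive_tree_skel indr => k kr; apply: HN; rewrite /= kr orbT.
have := solvable_and (solvable_skel (v := v) (x := x) sl xl)
                     (solvable_skel (v := v) (x := x) sr xr).
move=> /solvable_diag/(_ Hrank)[u []]; rewrite !subst2_diag /= => ul ur.
exact/ur/(ef_up (p_filter x) ul)/der.
Qed.

(** Completeness for the algebra of upsets. *)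
Lemma holds_S_BDI s :
  (forall v, @holds upset_algebra v (seq_map lc_of_si s)) -> S_BDI Phi s.
Proof.
case: s => a b /(_ (@clopen \o SVar)) Hab; apply: contrapT => nab.
have [||c ac cb|x [xa xb]] :=
    @prime_filter [set c | a ≼ c] [set c | c ≼ b].
- split=> /=; first exact: bdi_top.
    by move=> c d; apply: bdi_cut.
  by move=> c d; apply: bdi_andr.
- split=> /=; first exact: bdi_bot.
    by move=> c d cb dc; apply: bdi_cut dc cb.
  by move=> c d; apply: bdi_orl.
- exact/nab/(bdi_cut ac cb).
have substK c : si_subst SVar c = c by elim: c => //= c -> d ->.
have /truth_lemma : val (@clopen \o SVar) b x.
  by apply: Hab; apply/truth_lemma; rewrite substK; apply/xa/bdi_id.
by rewrite substK; apply/xb/bdi_id.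
Qed.

End Canonical.

(** * Conservativity *)

Lemma BDFNL_S_BDI (Phi : set si_sequent) (Psi : set bul_sequent) :
  (forall s, Phi s -> inductive_sequent s) ->
  (forall t, Psi t -> exists2 s, Phi s &
     ALC_derives (seq_map lc_of_si s) (seq_map lc_of_bul t)) ->
  forall s, BDFNL Psi (seq_map lc_of_si s) -> S_BDI Phi s.
Proof.
move=> indPhi PsiPhi s ders; apply: holds_S_BDI => v.
apply: (@BDFNL_sound (upset_algebra Phi) Psi _ _ ders v) => t /PsiPhi[r Phir].
move=> /(@ALC_derives_valid (upset_algebra Phi))[+ _]; apply=> w x.
apply: (inductive_canonical (indPhi r Phir)) => u; exact: bdi_ax.
Qed.

Theorem theorem8 (Phi : set si_sequent) (Psi : set bul_sequent)
    (hPhi : forall s : si_sequent, Phi s -> inductive_sequent s)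
    (hequiv : ALC_equiv Phi Psi) :
  forall s : si_sequent,
    S_BDI Phi s <-> BDFNL Psi (seq_map lc_of_si s).
Proof.
have [PhiPsi PsiPhi] := hequiv => s; split; first exact: S_BDI_BDFNL.
exact: BDFNL_S_BDI.
Qed.
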